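(* Suppose that $\mathrm{char}\,\Bbbk=0$. Let $d\ge2$ and $n\ge\binom{2+d}{d}$. A point $\mathbf{p}\in X_{2,d,n}$ is a smooth point of $X_{2,d,n}$ if and only if there exists a unique degree $d$ curve $C\subseteq\mathbb{P}^2$ passing through the points in $\mathbf{p}$ and the points in $\mathbf{p}$ that lie in the singular locus of $C$ are distinct.
   Context: $\Bbbk$ is a field, not necessarily algebraically closed; a point of a scheme means a $\Bbbk$-rational point. $X_{2,d,n}\subseteq(\mathbb{P}^2)^n$ is the closed subscheme parametrizing $n$-tuples $\mathbf{p}=(p_1,\ldots,p_n)$ of points lying on a common degree $d$ plane curve, with the scheme structure defined by the vanishing of the maximal minors (of size $\binom{2+d}{d}$) of the $\binom{2+d}{d}\times n$ matrix whose $i$-th column is the vector of all degree $d$ monomials in the homogeneous coordinates of the $i$-th point. ''The points in $\mathbf{p}$ that lie in the singular locus of $C$ are distinct'' means that $p_i\ne p_j$ whenever $i\neq j$ and $p_i,p_j\in C^{\mathrm{sing}}$. *)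

(* Defs.v *)
From HB Require Import structures.
From mathcomp Require Import all_boot all_order all_algebra.
From mathcomp Require Export ring_quotient.
From mathcomp Require Export mpoly.

Set Implicit Arguments.
Unset Strict Implicit.
Unset Printing Implicit Defensive.

Import GRing.Theory.
Local Open Scope ring_scope.

Section ProjectivePlane.
Variable k : fieldType.

(* Homogeneous coordinates of a k-rational point of P^2; two of them give the *)
(* same point of P^2 exactly when they are related by same_point.             *)
Definition point := {v : 'rV[k]_3 | v != 0}.

Definition coord (p : point) (j : 'I_3) : k := val p ord0 j.

(* (_ == _)%MS is equality of row spaces, i.e., of lines in k^3. *)
Definition same_point (p q : point) : bool := (val p == val q)%MS.

(* A plane curve of degree d, possibly non-reduced or reducible, is a nonzero *)
(* form of degree d up to a nonzero scalar (see same_curve).                  *)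
Definition is_curve (d : nat) (F : {mpoly k[3]}) : Prop :=
  F != 0 /\ F \is d.-homog.

Definition same_curve (F G : {mpoly k[3]}) : Prop :=
  exists2 a : k, a != 0 & G = a *: F.

Definition on_curve (F : {mpoly k[3]}) (p : point) : Prop := F.@[coord p] = 0.

Definition sing_curve (F : {mpoly k[3]}) (p : point) : Prop :=
  on_curve F p /\ forall j : 'I_3, (F^`M(j)).@[coord p] = 0.

Definition passes_through n (F : {mpoly k[3]}) (p : 'I_n -> point) : Prop :=
  forall i, on_curve F (p i).

Definition sing_points_distinct n (F : {mpoly k[3]}) (p : 'I_n -> point) :
    Prop :=
  forall i j, i != j -> sing_curve F (p i) -> sing_curve F (p j) ->
    ~~ same_point (p i) (p j).

End ProjectivePlane.

Definition monomials3 (d : nat) : seq 'X_{1..3} :=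
  [seq s2m t | t : d.-tuple 'I_3 <- enum (basis 3 d)].

Lemma mem_monomials3 d m : (m \in monomials3 d) = (mdeg m == d).
Proof. by rewrite basis_cover. Qed.

Lemma uniq_monomials3 d : uniq (monomials3 d).
Proof. exact: uniq_basis. Qed.

Lemma size_monomials3 d : size (monomials3 d) = 'C(2 + d, d).
Proof. by rewrite size_basis addnC. Qed.

Section Determinantal.
Variables (R : comNzRingType) (d n : nat).

(* The rows of x are the homogeneous coordinates of n points, with values in  *)
(* the base field or in the coordinate ring of a chart.                       *)
Definition monomial_mx (x : 'M[R]_(n, 3)) : 'M[R]_('C(2 + d, d), n) :=
  \matrix_(a, i) \prod_(j < 3) x i j ^+ (nth 0%MM (monomials3 d) a) j.

(* f chooses the columns. Choices with a repetition give 0 and reordering a   *)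
(* choice only changes the sign, so these generate the ideal of the maximal   *)
(* minors; there is nothing to restrict to increasing f.                      *)
Definition max_minor (x : 'M[R]_(n, 3)) (f : {ffun 'I_('C(2 + d, d)) -> 'I_n}) :
    R :=
  \det (colsub f (monomial_mx x)).

End Determinantal.

(* The closed subscheme Z of the affine s-space over k defined by the ideal I *)
(* generated by a finite family g, at a k-rational point a of Z.              *)
Section AffineSubscheme.
Variables (k : fieldType) (s : nat) (T : finType).
Variables (g : T -> {mpoly k[s]}) (a : 'I_s -> k).

Definition jacobian_mx : 'M[k]_(#|T|, s) :=
  \matrix_(t, j) ((g (enum_val t))^`M(j)).@[a].

(* The row space is the Zariski tangent space of Z at a, the dual of the      *)
(* fibre at a of the sheaf of differentials of Z over k.                      *)
Definition tangent_mx : 'M[k]_s := kermx jacobian_mx^T.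

Definition tangent_dim : nat := \rank tangent_mx.

(* P 0 < ... < P l are primes of k[x_1..x_s] that contain I and are contained *)
(* in the maximal ideal of a; these are the chains of primes of length l in   *)
(* the local ring of Z at a.                                                  *)
Definition prime_chain (l : nat) (P : nat -> {pred {mpoly k[s]}}) : Prop :=
  [/\ forall i, (i <= l)%N -> idealr_closed (P i) /\ prime_idealr_closed (P i),
      forall i, (i < l)%N ->
        {subset P i <= P i.+1} /\ (exists2 h, h \in P i.+1 & h \notin P i),
      forall t, g t \in P 0%N
    & forall h, h \in P l -> h.@[a] = 0].

(* The Krull dimension of the local ring of Z at a is e. *)
Definition local_dim (e : nat) : Prop :=
  (exists P, prime_chain e P) /\
  (forall l, (exists P, prime_chain l P) -> (l <= e)%N).

(* As a is k-rational, smoothness over k at a means that the tangent space,   *)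
(* or equally the fibre of the differentials, has the dimension of Z at a.    *)
Definition smooth_affine : Prop := local_dim tangent_dim.

End AffineSubscheme.

Section PointConfigurations.
Variables (k : fieldType) (d n : nat).

Definition points_mx (p : 'I_n -> point k) : 'M[k]_(n, 3) :=
  \matrix_(i, j) coord (p i) j.

(* p is a k-rational point of X_{2,d,n}. *)
Definition in_X (p : 'I_n -> point k) : Prop :=
  forall f : {ffun 'I_('C(2 + d, d)) -> 'I_n}, max_minor (points_mx p) f = 0.

(* For c : 'I_n -> 'I_3, the affine chart of (P^2)^n where the c i-th         *)
(* homogeneous coordinate of the i-th point is nonzero is Spec k[x_(i, j)],   *)
(* i < n and j < 2, the variables being numbered by mxvec_index. Here x_(i, j)*)
(* is the ratio of the lift (c i) j-th and the c i-th coordinates.            *)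
Definition in_chart (c : 'I_n -> 'I_3) (p : 'I_n -> point k) : Prop :=
  forall i, coord (p i) (c i) != 0.

Definition chart_mx (c : 'I_n -> 'I_3) : 'M[{mpoly k[n * 2]}]_(n, 3) :=
  \matrix_(i, j) if unlift (c i) j is Some j' then 'X_(mxvec_index i j') else 1.

Definition chart_coord (c : 'I_n -> 'I_3) (p : 'I_n -> point k) :
    'I_(n * 2) -> k :=
  mxvec (\matrix_(i < n, j < 2)
           (coord (p i) (lift (c i) j) / coord (p i) (c i))) ord0.

Definition X_chart_eqs (c : 'I_n -> 'I_3)
    (f : {ffun 'I_('C(2 + d, d)) -> 'I_n}) : {mpoly k[n * 2]} :=
  max_minor (chart_mx c) f.

(* Smoothness is local, so the choice of a chart around p is irrelevant. *)
Definition smooth_point_X (p : 'I_n -> point k) : Prop :=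
  exists c : 'I_n -> 'I_3,
    in_chart c p /\ smooth_affine (X_chart_eqs c) (chart_coord c p).

End PointConfigurations.

(* Main.v *)
Require Import Defs.
From mathcomp Require Import all_boot all_order all_algebra.
From HB Require Import structures.
From mathcomp Require Import ring zify.
From Stdlib Require Import ClassicalEpsilon.

Set Implicit Arguments.
Unset Strict Implicit.
Unset Printing Implicit Defensive.

Import GRing.Theory.
Local Open Scope ring_scope.

(** Write N for 'C(2 + d, d) and M for the N x n matrix of the degree d
    monomials at the points p_i. A row vector w with w *m M = 0 is the vector of
    coefficients of a form F vanishing at all p_i, so there is a unique curve
    through the points exactly when M has rank N - 1. The dimension of X at
    p is at most n + N - 1, and the rank r of the Jacobian matrix of the maximal
    minors is at most n - N + 1. As the tangent space has dimension 2n - r, X is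
    smooth at p exactly when both are equalities. The second one turns out to be
    equivalent to the condition on the curve, and to imply the first.

    Dimension. Modulo a prime containing the minors, the generic points have
    coordinates in a field K and lie on a curve of degree d over K. Divide its
    equation by one nonzero coefficient: the N - 1 others, with one affine
    coordinate of each point, make all coordinates algebraic over n + N - 1
    elements. A chain of primes of length l yields l algebraically independent
    elements, so l <= n + N - 1; this is X_chain_length.

    Tangent space. Differentiating w *m M_f times the adjugate of the N x N
    matrix M_f of a choice f of columns shows that the differentials of the
    minors are combinations, by vectors c with M c = 0, of the differentials
    dF(p_i), taken as n rows in separate blocks of coordinates (jac_sub).
    Moreover they all vanish when M has rank less than N - 1 (jac_eq0). The row
    dF(p_i) is zero exactly when p_i is singular on F = 0. If X is smooth at p,
    the dimension bound makes the Jacobian of rank at least n - N + 1. Hence M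
    has rank N - 1, that is, the curve is unique, and no nonzero c with M c = 0
    is supported on singular points. But two equal singular points give such
    a c, as two columns of M are then proportional.

    Conversely let F be the unique curve, with distinct singular points among
    the p_i. A vector c with M c = 0 supported on singular points is a linear
    relation between the values there of all forms of degree d, and the
    geometric heart of the proof, singular_points_independent, is that c = 0.
    So n - N + 1 of the minors have independent differentials at p, and they can
    be chosen to generate all minors up to the radical near p (good_minors). For
    functions with independent differentials, solving equations by Newton
    iteration produces enough primes (regular_chain) to get a chain of length
    2n - (n - N + 1) = n + N - 1 above the minors: X is smooth at p.

    Independence of the singular points. Take affine coordinates x, y with F
    monic in y and the singular points (a_q, b_q) having distinct a_q, and let
    lam be a relation between them. Put p = prod_q (x - a_q) and
      H = sum_q lam_q * (F(x, y) - F(x, b_q)) / (y - b_q) * p / (x - a_q).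
    The relation lowers the degree of H below that of p. As the points are
    double, multiplication by H maps the ideal J of these points into
    p J + (F). So H / p is integral over the coordinate ring of the curve, and
    of negative degree; a large power of it times p is a polynomial of negative
    degree, so it vanishes. Thus F divides a power of H. If lam is not 0, then H is
    a nonzero polynomial of degree less than d in y, so gcd(F, H) is a proper
    factor of F with the same zeros: a second curve through the points. *)

(** * Polynomials in several variables *)

Lemma mpoly_ring_ind n (R : nzRingType) (P : {mpoly R[n]} -> Prop) :
    (forall c, P c%:MP) -> (forall i, P 'X_i) ->
    (forall f g, P f -> P g -> P (f + g)) ->
    (forall f g, P f -> P g -> P (f * g)) ->
  forall f, P f.
Proof.
move=> PC PX PD PM f; have P1 : P 1 by rewrite -mpolyC1; apply: PC.
rewrite [f]mpolyE; apply: big_ind => // [|m _]; first by rewrite -mpolyC0.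
rewrite -mul_mpolyC; apply: (PM) => //; rewrite mpolyXE_id.
by apply: big_ind => // i _; elim: (m i) => [|e IH]; rewrite ?exprS; auto.
Qed.

(** Membership in the square of the ideal generated by the y_i, which is the
    form in which second order remainders are used below. *)
Definition quadratic n (S : comNzRingType) (y : 'I_n -> S) (z : S) :=
  exists r : 'I_n -> 'I_n -> S, z = \sum_i \sum_j r i j * (y i * y j).

Section Quadratic.
Variables (n : nat) (S : comNzRingType) (y : 'I_n -> S).
Implicit Types z : S.

Lemma quadratic0 : quadratic y 0.
Proof.
by exists (fun _ _ => 0); rewrite big1 // => i _; rewrite big1 // => j _;
  rewrite mul0r.
Qed.

Lemma quadraticD z1 z2 :
  quadratic y z1 -> quadratic y z2 -> quadratic y (z1 + z2).
Proof.
move=> [r ->] [s ->]; exists (fun i j => r i j + s i j).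
rewrite -big_split; apply: eq_bigr => i _; rewrite -big_split.
by apply: eq_bigr => j _; rewrite mulrDl.
Qed.

Lemma quadraticM a z : quadratic y z -> quadratic y (a * z).
Proof.
move=> [r ->]; exists (fun i j => a * r i j).
rewrite mulr_sumr; apply: eq_bigr => i _; rewrite mulr_sumr.
by apply: eq_bigr => j _; rewrite mulrA.
Qed.

Lemma quadratic_mul_sums (a b : 'I_n -> S) :
  quadratic y ((\sum_i a i * y i) * (\sum_i b i * y i)).
Proof.
exists (fun i j => a i * b j); rewrite mulr_suml; apply: eq_bigr => i _.
by rewrite mulr_sumr; apply: eq_bigr => j _; rewrite mulrACA.
Qed.

End Quadratic.

(** The ring of polynomials satisfying the first order Taylor formula contains
    the constants and the variables. *)
Lemma mmap_taylor n (k S : comNzRingType) (f : {rmorphism k -> S})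
    (x y : 'I_n -> S) (h : {mpoly k[n]}) :
  exists2 z, quadratic y z &
    mmap f (fun i => x i + y i) h =
      mmap f x h + \sum_i mmap f x h^`M(i) * y i + z.
Proof.
elim/mpoly_ring_ind: h => [c|i|g h [q Hq Eq] [r Hr Er]|g h [q Hq Eq] [r Hr Er]].
- exists 0; first exact: quadratic0.
  by rewrite !mmapC big1 ?addr0 // => i _; rewrite mderivC mmap0 mul0r.
- exists 0; first exact: quadratic0.
  rewrite !mmapX !mmap1U (bigD1 i) //= big1 => [|j ji].
    rewrite mderivX mnm1E eqxx scale1r addr0.
    rewrite (_ : (U_(i) - U_(i))%MM = 0%MM); last first.
      by apply/mnmP => j; rewrite mnmBE subnn mnm0E.
    by rewrite mmapX mmap11 mul1r !addr0.
  by rewrite mderivX mnm1E eq_sym (negPf ji) scale0r mmap0 mul0r.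
- exists (q + r); first exact: quadraticD.
  rewrite !mmapD Eq Er.
  have -> : \sum_i mmap f x (g + h)^`M(i) * y i =
     \sum_i mmap f x g^`M(i) * y i + \sum_i mmap f x h^`M(i) * y i.
    by rewrite -big_split; apply: eq_bigr => i _; rewrite mderivD mmapD mulrDl.
  ring.
have -> : \sum_i mmap f x (g * h)^`M(i) * y i =
   mmap f x h * (\sum_i mmap f x g^`M(i) * y i) +
   mmap f x g * (\sum_i mmap f x h^`M(i) * y i).
  rewrite !mulr_sumr -big_split; apply: eq_bigr => i _.
  by rewrite mderivM mmapD !rmorphM /=; ring.
rewrite !rmorphM /= Eq Er.
set dg := \sum_i _; set dh := \sum_i _.
exists (dg * dh + ((mmap f x h + dh) * q + (mmap f x g + dg + q) * r)).
  apply: quadraticD; first exact: quadratic_mul_sums.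
  by apply: quadraticD; apply: quadraticM.
ring.
Qed.

(** Both sides have the same coefficients, up to splitting the last exponent
    off each monomial. *)
Lemma muni_neq0 n (R : comNzRingType) (f : {mpoly R[n.+1]}) :
  f != 0 -> muni f != 0.
Proof.
move=> f0; apply: contraNneq f0 => uf0; apply/eqP/mpolyP => m; rewrite mcoeff0.
pose tr (m : 'X_{1..n.+1}) : 'X_{1..n} :=
  [multinom m (widen_ord (leqnSn n) i) | i < n].
have := congr1 (fun g : {poly {mpoly R[n]}} => g`_(m ord_max)@_(tr m)) uf0.
rewrite muniE coef_sum raddf_sum coef0 mcoeff0 /= => E; rewrite -[RHS]E.
rewrite {1}[f]mpolyE raddf_sum; apply: eq_bigr => m' _ /=.
rewrite coefZ coefXn mulr_natr raddfMn /= !mcoeffZ !mcoeffX -[RHS]mulr_natr.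
rewrite -mulrA -natrM mulnb; congr (_ * (nat_of_bool _)%:R).
apply/eqP/andP => [-> //|[/eqP Et /eqP Em]].
apply/mnmP => i; case: (unliftP ord_max i) => [j ->|-> //].
have := congr1 (fun m : 'X_{1..n} => m j) Et; rewrite !mnmE.
by congr (m' _ = m _); apply: val_inj; rewrite /= /bump leqNgt ltn_ord.
Qed.

Lemma mmapM n (R : nzRingType) (S : comNzRingType) (f : {rmorphism R -> S})
  (h : 'I_n -> S) : {morph mmap f h : p q / p * q}.
Proof. exact: rmorphM. Qed.

Lemma mmap_muni n (R S : comNzRingType) (f : {rmorphism R -> S}) (w : 'I_n.+1 -> S) g :
  mmap f w g =
    (map_poly (mmap f (fun i => w (widen_ord (leqnSn n) i))) (muni g)).[w ord_max].
Proof.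
set w' := fun i => _.
elim/mpoly_ring_ind: g => [c|i|g h Eg Eh|g h Eg Eh].
- by rewrite muniC map_polyC hornerC /= !mmapC.
- rewrite mmapX mmap1U muniE msuppX big_seq1 mcoeffX eqxx scale1r.
  rewrite map_polyZ map_polyXn hornerZ hornerXn /= mmapX mnm1E.
  case: (unliftP ord_max i) => [j|] ->; last first.
    rewrite eqxx expr1 /mmap1 big1 ?mul1r // => l _; rewrite mnmE mnm1E -val_eqE /=.
    by rewrite gtn_eqF.
  rewrite [lift _ _ == _]eq_sym (negPf (neq_lift _ _)) expr0 mulr1 /mmap1.
  have Ej : widen_ord (leqnSn n) j = lift ord_max j.
    by apply: val_inj; rewrite /= /bump leqNgt ltn_ord.
  rewrite (bigD1 j) //= big1 ?mulr1 => [|l lj]; rewrite mnmE mnm1E -val_eqE /=.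
    by rewrite /bump leqNgt ltn_ord /= add0n eqxx expr1 /w' Ej.
  by rewrite /bump leqNgt ltn_ord /= add0n eq_sym val_eqE (negPf lj) expr0.
- rewrite mmapD (muniD g h) Eg Eh -hornerD; congr (_.[_]).
  by rewrite rmorphD.
- rewrite mmapM (muniM g h) Eg Eh -hornerM; congr (_.[_]).
  by rewrite rmorphM.
Qed.

Lemma pchar0_natr_inj (k : fieldType) :
  [pchar k] =i pred0 -> injective (fun i : nat => i%:R : k).
Proof.
move=> /pcharf0P k0 i j Eij; have k0' m l : (m <= l)%N -> m%:R = l%:R :> k -> m = l.
  move=> le_ml /eqP; rewrite eq_sym -subr_eq0 -natrB // k0 subn_eq0 => le_lm.
  by apply/eqP; rewrite eqn_leq le_ml.
by case: (leqP i j) => [/k0' -> //|/ltnW /k0' ->].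
Qed.

Lemma poly_nonroot (k : fieldType) (hk : [pchar k] =i pred0) (f : {poly k}) :
  f != 0 -> exists t, f.[t] != 0.
Proof.
move=> f0; pose s := [seq i%:R : k | i <- iota 0 (size f)].
have us : uniq s.
  rewrite map_inj_in_uniq ?iota_uniq // => i j _ _; exact: pchar0_natr_inj.
have : ~~ all (root f) s.
  apply/negP => /(max_poly_roots f0) /(_ us).
  by rewrite size_map size_iota ltnn.
by case/allPn => t _ ft; exists t.
Qed.

(** A field of characteristic 0 is infinite, so a nonzero polynomial does not
    vanish identically: evaluate the last variable after the others. *)
Lemma mpoly_nonroot (k : fieldType) (hk : [pchar k] =i pred0) n
    (f : {mpoly k[n]}) : f != 0 -> exists v, f.@[v] != 0.
Proof.
elim: n f => [|n IH] f f0.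
  exists (fun=> 0); apply: contraNneq f0.
  by rewrite (nvar0_mpolyC f) mevalC => ->; rewrite mpolyC0.
have /IH [v hv] : lead_coef (muni f) != 0 by rewrite lead_coef_eq0 muni_neq0.
have /(poly_nonroot hk) [t ht] : map_poly (meval v) (muni f) != 0.
  by rewrite map_poly_eq0_id0 // muni_neq0.
pose w i := if unlift ord_max i is Some j then v j else t.
exists w; rewrite /meval mmap_muni /w unlift_none; apply: contraNneq ht => <-.
apply/eqP; congr (_.[_]); apply: eq_map_poly => g.
apply: eq_bigr => m _; congr (_ * _); apply: mmap1_eq => i.
rewrite (_ : widen_ord _ i = lift ord_max i) ?liftK //.
by apply: val_inj; rewrite /= /bump leqNgt ltn_ord.
Qed.

(** * Fields attached to prime ideals *)

Definition asb (P : Prop) : bool :=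
  if excluded_middle_informative P then true else false.

Lemma asbP (P : Prop) : reflect P (asb P).
Proof. by rewrite /asb; case: excluded_middle_informative => ?; constructor. Qed.

(** The fraction field needs inverses of units to be chosen in R, which takes
    the excluded middle and a choice principle. *)
Lemma domain_field (R : comNzRingType) :
    GRing.integral_domain_axiom R ->
  exists (K : fieldType) (f : {rmorphism R -> K}), injective f.
Proof.
move=> intR.
pose u (x : R) := asb (exists y, y * x = 1).
have ex (x : R) : exists y, if u x then y * x = 1 else y = x.
  by rewrite /u; case: asbP => // _; exists x.
pose iv x := sval (constructive_indefinite_description _ (ex x)).
have ivP x : if u x then iv x * x = 1 else iv x = x.
  by rewrite /iv; case: constructive_indefinite_description.
have mulVx : {in u, left_inverse 1 iv *%R}.
  by move=> x ux; have := ivP x; rewrite -topredE /= in ux; rewrite ux.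
have uPl x y : y * x = 1 -> u x by move=> yx1; apply/asbP; exists y.
have iv_out : {in [predC u], iv =1 id}.
  by move=> x; rewrite inE /= -topredE /= => /negPf ux; have := ivP x; rewrite ux.
pose m1 := GRing.ComNzRing_hasMulInverse.Build R mulVx uPl iv_out.
pose U : comUnitRingType := HB.pack R m1.
pose m2 := GRing.ComUnitRing_isIntegral.Build U intR.
pose D : idomainType := HB.pack U m2.
exists {fraction D}, (@FracField.tofrac D : {rmorphism D -> {fraction D}}).
by move=> x y /eqP; rewrite tofrac_eq => /eqP.
Qed.

(** K is the fraction field of R modulo P. All arguments with a prime of a
    polynomial ring below take place over this K, where linear algebra applies. *)
Lemma prime_field (R : comNzRingType) (P : {pred R}) :
    idealr_closed P -> prime_idealr_closed P ->
  exists (K : fieldType) (f : {rmorphism R -> K}), forall x, (f x == 0) = (x \in P).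
Proof.
move=> idP prP.
pose m1 := isIdealr.Build R P idP.
pose m2 := isPrimeIdealrClosed.Build R (P : R -> bool) prP.
pose I : prime_idealr R := HB.pack (P : R -> bool) m1 m2.
have [K [f f_inj]] := domain_field (@Quotient.rquot_IdomainAxiom R I).
pose pi := (\pi_{ideal_quot I})%qT; exists K, (f \o pi : {rmorphism R -> K}) => x /=.
rewrite -(rmorph0 f) (inj_eq f_inj) -[X in _ == X](rmorph0 pi) eq_sym.
by rewrite -Quotient.idealrBE sub0r rpredN.
Qed.

(** * Double points of an affine plane curve *)

Lemma irreducible_factor (k : fieldType) (f : {poly k}) :
  (1 < size f)%N -> exists2 g, irreducible_poly g & g %| f.
Proof.
move=> f1.
pose S n := asb (exists2 g : {poly k}, g %| f & (1 < size g)%N && (size g == n)).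
have exS : exists n, S n by exists (size f); apply/asbP; exists f; rewrite ?f1 /=.
case: (ex_minnP exS) => n /asbP [g gf /andP [g1 /eqP gn]] gmin.
exists g => //; split=> // q q1 qg; rewrite -(dvdp_size_eqp qg) eqn_leq gn.
have g0 : g != 0 by rewrite -size_poly_gt0 (ltn_trans _ g1).
have q0 : q != 0 by apply: contraTneq qg => ->; rewrite dvd0p.
rewrite -{1}gn dvdp_leq //=; apply: gmin; apply/asbP; exists q.
  exact: dvdp_trans gf.
by rewrite eqxx andbT ltn_neqAle eq_sym q1 size_poly_gt0.
Qed.

(** Gauss's lemma: k[x] modulo c is a domain, hence so are the polynomials
    over it. *)
Lemma gauss_prime (k : fieldType) (c : {poly k}) (f g : {poly {poly k}}) :
    irreducible_poly c -> (forall i, c %| (f * g)`_i) ->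
  (forall i, c %| f`_i) \/ (forall i, c %| g`_i).
Proof.
move=> [c1 irr] cfg.
pose P : {pred {poly k}} := [pred h | c %| h].
have idP : idealr_closed P.
  split=> [||a u v]; rewrite !inE ?dvdp0 //.
    by rewrite dvdp1 gtn_eqF.
  by move=> cu cv; rewrite dvdp_add ?dvdp_mull.
have prP : prime_idealr_closed P.
  move=> u v; rewrite !inE => cuv; case: (boolP (c %| u)) => //= cu.
  rewrite -(@Gauss_dvdpr _ _ u) // /coprimep.
  apply: contraNT cu => gcd1; have := irr _ gcd1 (dvdp_gcdl c u).
  by move/eqp_dvdl <-; exact: dvdp_gcdr.
have [K [h hP]] := prime_field idP prP.
have h0 (q : {poly {poly k}}) : map_poly h q = 0 <-> forall i, c %| q`_i.
  split=> [q0 i|q0]; first by rewrite -[_ %| _](hP) -coef_map q0 coef0.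
  by apply/polyP => i; rewrite coef_map coef0; apply/eqP; rewrite hP; exact: q0.
have /h0 /eqP := cfg; rewrite rmorphM mulf_eq0.
by case/orP => /eqP /h0; [left|right].
Qed.

(** A factorization over the field k(x), with its denominator c cleared,
    descends to k[x][y]: the irreducible factors of c are cancelled one at a time
    from G or from E. *)
Lemma gauss_split (k : fieldType) (c : {poly k}) (F G E : {poly {poly k}}) :
    c != 0 -> c *: F = G * E ->
  exists G' E', [/\ F = G' * E' & G' %= G].
Proof.
move: {2}(size c) (leqnn (size c)) => n.
elim: n c G E => [|n IH] c G E.
  by rewrite size_poly_leq0 => ->.
move=> cn c0 EF; case: (leqP (size c) 1) => [c1|/irreducible_factor [q irr qc]].
  have /size_poly1P [e e0 Ec] : size c == 1%N by rewrite eqn_leq c1 size_poly_gt0.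
  exists G, (e^-1%:P *: E); split; last exact: eqpxx.
  by rewrite -scalerAr -EF Ec scalerA -polyCM mulVf // polyC1 scale1r.
have q0 : q != 0 by apply: contraTneq irr.1 => ->; rewrite size_poly0.
have [c' Ec] : exists c', c = c' * q by exists (c %/ q); rewrite divpK.
have c'0 : c' != 0 by apply: contraNneq c0; rewrite Ec => ->; rewrite mul0r.
have c'n : (size c' <= n)%N.
  move: cn irr.1; rewrite Ec size_mul //; move: (size c') (size q); lia.
have dq (f : {poly {poly k}}) : (forall i, q %| f`_i) -> exists f', f = q *: f'.
  move=> qf; exists (map_poly (fun h => h %/ q) f); apply/polyP => i.
  by rewrite coefZ coef_map_id0 ?div0p // mulrC divpK.
have /(gauss_prime irr) : forall i, q %| (G * E)`_i.
  by move=> i; rewrite -EF coefZ dvdp_mulr.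
have qI : injective (fun f : {poly {poly k}} => q *: f).
  move=> f g /eqP; rewrite -subr_eq0 -scalerBr scale_poly_eq0 (negPf q0) subr_eq0.
  by move/eqP.
case=> /dq [f Ef]; rewrite {}Ef in EF *.
  have [|||G' [E' [-> GG']]] := IH c' f E => //.
    by apply: qI; rewrite /= scalerA mulrC -Ec EF scalerAl.
  exists G', E'; split=> //.
  by rewrite (eqp_trans GG') // eqp_sym eqp_scale.
have [|||G' [E' [-> GG']]] := IH c' G f => //.
  by apply: qI; rewrite /= scalerA mulrC -Ec EF scalerAr.
by exists G', E'.
Qed.

(** The quotient (f - f(c)) / ('X - c), by an explicit formula from which
    degrees in both variables can be read off. *)
Definition divdiff (R : nzRingType) (f : {poly R}) (c : R) : {poly R} :=
  \sum_(j < size f) f`_j *: \sum_(u < j) c ^+ u *: 'X^(j.-1 - u).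

Lemma divdiffP (R : comNzRingType) (f : {poly R}) c :
  f = ('X - c%:P) * divdiff f c + f.[c]%:P.
Proof.
apply/eqP; rewrite -subr_eq; apply/eqP.
rewrite /divdiff horner_coef rmorph_sum /= mulr_sumr -{1}[f]coefK poly_def -sumrB.
apply: eq_bigr => j _.
rewrite -scalerAr -[f`_j *: 'X^j]mul_polyC polyCM -mulrBr polyC_exp subrXX.
rewrite -mul_polyC; congr (_ * (_ * _)); apply: eq_bigr => u _.
by rewrite -mul_polyC polyC_exp mulrC.
Qed.

(** Total degree at most D in k[x][y]; the product with 'X^j adds the exponent j
    of y to the degree of the coefficient, and it makes 0 a harmless case. *)
Definition deg_le {k : fieldType} (D : nat) (f : {poly {poly k}}) :=
  forall j, (size (f`_j * 'X^j)%R <= D.+1)%N.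

Section DegLe.
Variable k : fieldType.
Implicit Types f g : {poly {poly k}}.

Lemma deg_le0 D : deg_le D (0 : {poly {poly k}}).
Proof. by move=> j; rewrite coef0 mul0r size_poly0. Qed.

Lemma deg_leD D f g : deg_le D f -> deg_le D g -> deg_le D (f + g).
Proof.
move=> fD gD j; rewrite coefD mulrDl.
by rewrite (leq_trans (size_polyD _ _)) // geq_max fD gD.
Qed.

Lemma deg_le_sum D (I : Type) (r : seq I) (P : pred I) F :
  (forall i, P i -> deg_le D (F i : {poly {poly k}})) ->
  deg_le D (\sum_(i <- r | P i) F i).
Proof. by move=> FD; apply: big_ind => //; [exact: deg_le0 | exact: deg_leD]. Qed.

Lemma deg_leM D E f g : deg_le D f -> deg_le E g -> deg_le (D + E) (f * g).
Proof.
move=> fD gE j; rewrite coefM mulr_suml.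
apply: (leq_trans (size_sum _ _ _)); apply/bigmax_leqP => i _.
have -> : 'X^j = 'X^i * 'X^(j - i) :> {poly k} by rewrite -exprD subnKC ?leq_ord.
rewrite mulrACA.
apply: leq_trans (size_polyMleq _ _) _.
by have := fD i; have := gE (j - i)%N; move: (size _) (size _); lia.
Qed.

Lemma deg_leX D f r : deg_le D f -> deg_le (D * r) (f ^+ r).
Proof.
move=> fD; elim: r => [|r IH]; last by rewrite exprS mulnS; exact: deg_leM.
move=> [|j]; rewrite expr0 muln0 coef1 ?mul0r ?size_poly0 //.
by rewrite mulr1 size_poly1.
Qed.

Lemma deg_leCXn D c j : (size (c * 'X^j)%R <= D.+1)%N ->
  deg_le D (c%:P * 'X^j : {poly {poly k}}).
Proof.
move=> h i; rewrite coefCM coefXn; case: eqP => [->|_]; first by rewrite mulr1.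
by rewrite mulr0 mul0r size_poly0.
Qed.

Lemma deg_leC D (c : {poly k}) : (size c <= D.+1)%N -> deg_le D (c%:P : {poly {poly k}}).
Proof. by move=> h; have := @deg_leCXn D c 0; rewrite !expr0 !mulr1; apply. Qed.

(** Substituting x y for y turns the total degree into the degree in x. *)
Let dilate f := f \Po ('X%:P * 'X).

Let coef_dilate f j : (dilate f)`_j = f`_j * 'X^j.
Proof.
rewrite coef_comp_poly; under eq_bigr do rewrite exprMn -polyC_exp coefCM coefXn.
case: (ltnP j (size f)) => [jf|fj].
  rewrite (bigD1 (Ordinal jf)) //= eqxx mulr1 big1 ?addr0 // => i.
  by rewrite -val_eqE /= eq_sym => /negPf ->; rewrite !mulr0.
rewrite nth_default // mul0r big1 // => i _.
by rewrite gtn_eqF ?mulr0 // (leq_trans _ fj).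
Qed.

Let deg_leE D f : deg_le D f <-> (sizeY (dilate f) <= D.+1)%N.
Proof.
split=> [fD|fD j]; last by rewrite -coef_dilate (leq_trans (max_size_coefXY _ _)).
by apply/bigmax_leqP => j _; rewrite coef_dilate.
Qed.

Lemma deg_le_divisor D f g : g != 0 -> deg_le D (f * g) -> deg_le D f.
Proof.
move=> g0; have [->|f0] := eqVneq f 0; first by move=> _; exact: deg_le0.
have d0 h : h != 0 -> swapXY (dilate h) != 0.
  apply: contraNneq => /eqP; rewrite swapXY_eq0 => /eqP h0; apply/eqP/polyP => j.
  have /eqP := congr1 (fun p : {poly {poly k}} => p`_j) h0.
  by rewrite coef_dilate coef0 mulf_eq0 expf_eq0 polyX_eq0 andbF orbF => /eqP.
have dM : dilate (f * g) = dilate f * dilate g by rewrite /dilate rmorphM.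
rewrite !deg_leE !sizeYE dM rmorphM size_mul ?d0 //.
have le_pred m n l : (0 < n -> (m + n).-1 <= l -> m <= l)%N by lia.
by apply: le_pred; rewrite size_poly_gt0 d0.
Qed.

(** Euclidean division by F in the variable y does not increase the total
    degree, as F has the same degree in y as in total. *)
Lemma deg_le_mod d D F f : F \is monic -> size F = d.+1 -> deg_le d F ->
  deg_le D f -> exists Q f', [/\ f = F * Q + f', (size f' <= d)%N & deg_le D f'].
Proof.
move=> Fm sF dF; have [n] := ubnP (size f); elim: n f => // n IH f /ltnSE fn fD.
case: (leqP (size f) d) => [|df]; first by exists 0, f; rewrite mulr0 add0r.
have sf : (size f).-1.+1 = size f by rewrite prednK // (leq_ltn_trans _ df).
pose T := (lead_coef f)%:P * 'X^((size f).-1 - d) : {poly {poly k}}.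
have dfd : (d <= (size f).-1)%N by rewrite -ltnS sf.
have f0 : f != 0 by rewrite -size_poly_gt0 -sf.
have Td : ((size f).-1 = (size f).-1 - d + d)%N by rewrite subnK.
have l0 : (0 < size (lead_coef f))%N by rewrite size_poly_gt0 lead_coef_eq0.
have dD : deg_le (D - d) T /\ (d <= D)%N.
  have := fD (size f).-1; rewrite -/(lead_coef f) {1}Td.
  rewrite size_mulXn ?lead_coef_eq0 // => h; split; last by lia.
  apply: deg_leCXn; rewrite size_mulXn ?lead_coef_eq0 //.
  by move: h; lia.
have [||Q [f' [Ef sf' f'D]]] := IH (f - F * T).
- apply: leq_trans (_ : (size f).-1.+1 <= n)%N; last by rewrite sf.
  rewrite ltnS; apply/leq_sizeP => i fi.
  rewrite coefB /T mulrCA mul_polyC coefZ coefMXn ltnNge.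
  have -> /= : ((size f).-1 - d <= i)%N by rewrite (leq_trans _ fi) ?leq_subr.
  case: (ltngtP i (size f).-1) fi => // [fi|->] _.
    have Fi : (d.+1 <= i - ((size f).-1 - d))%N.
      by rewrite ltn_subRL -Td.
    by rewrite !nth_default ?mulr0 ?subrr ?sF // -sf.
  rewrite subKn // -/(lead_coef f).
  have -> : F`_d = 1 by move: Fm; rewrite monicE /lead_coef sF => /eqP.
  by rewrite mulr1 subrr.
- apply: deg_leD => //; rewrite -mulrN -(subnKC dD.2); apply: deg_leM => //.
  by move=> j; rewrite coefN mulNr size_polyN; exact: dD.1.
exists (Q + T), f'; split=> //.
by rewrite mulrDr addrAC -Ef subrK.
Qed.

End DegLe.

(** F lies in the square of the ideal of the point (a, b). *)
Definition double_pt {k : fieldType} (F : {poly {poly k}}) (a b : k) :=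
  exists u v w : {poly {poly k}},
    F = ('X - a%:P)%:P ^+ 2 * u + ('X - a%:P)%:P * ('X - b%:P%:P) * v
        + ('X - b%:P%:P) ^+ 2 * w.

(** The points (a q, b q) are double points of F, and lam is a relation between
    the values at these points of the polynomials of degree at most d. The
    polynomial H below plays the role of the function H / p on the curve F = 0
    that the relation defines. *)
Section AffineCurve.
Variables (k : fieldType) (F : {poly {poly k}}) (d : nat).
Variables (I : finType) (a b lam : I -> k).

Local Notation "f .[ x , y ]" := (f.[y%:P].[x]).

Hypotheses (Fm : F \is monic) (sF : size F = d.+1) (dF : deg_le d F).
Hypothesis a_inj : injective a.

Let X q : {poly k} := 'X - (a q)%:P.
Let Y q : {poly {poly k}} := 'X - ((b q)%:P)%:P.
Let p : {poly k} := \prod_q X q.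
Let G q := divdiff F (b q)%:P.

Hypothesis Fsing : forall q, double_pt F (a q) (b q).

Let XY0 q : (X q).[a q] = 0 /\ (Y q).[(b q)%:P] = 0.
Proof. by split; rewrite hornerXsubC subrr. Qed.

Let X_neq0 q : X q != 0. Proof. by rewrite polyXsubC_eq0. Qed.
Let horner_quad (R : comNzRingType) (A B u v w : {poly R}) c :
  (A ^+ 2 * u + A * B * v + B ^+ 2 * w).[c] =
    A.[c] ^+ 2 * u.[c] + A.[c] * B.[c] * v.[c] + B.[c] ^+ 2 * w.[c].
Proof. by rewrite !hornerE. Qed.

(** At a double point, F(x, b q) is divisible by X q ^ 2, and so both the
    quotient G q and the cofactor P vanish at the point. *)
Let F_dec q : exists P : {poly k},
  [/\ F = Y q * G q + (X q * P)%:P, (G q).[a q, b q] = 0 & P.[a q] = 0].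
Proof.
have [u [v [w EF]]] := Fsing q; rewrite -/(X q) -/(Y q) in EF.
have EFG := divdiffP F (b q)%:P; rewrite -/(G q) -/(Y q) in EFG.
have [P EP] : exists P, F.[(b q)%:P] = X q * P.
  exists (X q * u.[(b q)%:P]).
  by rewrite EF horner_quad hornerC (XY0 q).2; ring.
rewrite EP in EFG.
have P0 : P.[a q] = 0.
  have EP' : X q * P = X q * (X q * u.[(b q)%:P]).
    by rewrite -EP EF horner_quad hornerC (XY0 q).2; ring.
  by rewrite (mulfI (X_neq0 q) EP') hornerM (XY0 q).1 mul0r.
exists P; split=> //.
pose e := map_poly (horner_eval (a q)).
have eX : e (X q)%:P = 0 by rewrite /e map_polyC /= /horner_eval (XY0 q).1.
have eY : e (Y q) = 'X - (b q)%:P.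
  by rewrite /e rmorphB /= map_polyX map_polyC /= /horner_eval hornerC.
have E1 : e F = ('X - (b q)%:P) * e (G q).
  rewrite EFG polyCM; have -> A B C D : e (A * B + C * D) = e A * e B + e C * e D.
    by rewrite /e !(rmorphD, rmorphM).
  by rewrite eX eY mul0r addr0.
have E2 : e F = ('X - (b q)%:P) * (('X - (b q)%:P) * e w).
  rewrite EF; have -> A B u' v' w' : e (A ^+ 2 * u' + A * B * v' + B ^+ 2 * w') =
      e A ^+ 2 * e u' + e A * e B * e v' + e B ^+ 2 * e w'.
    by rewrite /e !(rmorphD, rmorphM, rmorphXn).
  by rewrite eX eY; ring.
have E3 : e (G q) = ('X - (b q)%:P) * e w.
  by apply: (mulfI (negbT (polyXsubC_eq0 (b q)))); rewrite -E1 -E2.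
transitivity ((e (G q)).[b q]); last by rewrite E3 hornerM hornerXsubC subrr mul0r.
by rewrite -[b q in RHS](hornerC _ (a q)) -/(horner_eval _ _) horner_map.
Qed.

Let van (w : {poly {poly k}}) := forall q, w.[a q, b q] = 0.

(** The step G q * J <= X q * J + (F) for the ideal J of the points: a w in J is
    Y q * be + X q * g, and Y q * G q is - X q * P modulo F. The new w' is in J at
    the point q because G q and P vanish there, and at the other points because
    X q does not. *)
Let van_step q w : van w -> exists w' E,
  van w' /\ G q * w = (X q)%:P * w' + F * E.
Proof.
move=> w0; have [P [EF G0 P0]] := F_dec q.
have Ew := divdiffP w (b q)%:P; rewrite -/(Y q) in Ew.
have [g Eg] : exists g, w.[(b q)%:P] = X q * g.
  have /factor_theorem [g Eg] : root w.[(b q)%:P] (a q) by apply/rootP/w0.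
  by exists g; rewrite mulrC.
rewrite {}Eg in Ew; set be := divdiff w _ in Ew.
pose w' := G q * g%:P - P%:P * be; exists w', be.
have E : G q * w = (X q)%:P * w' + F * be by rewrite Ew EF /w' !polyCM; ring.
split=> // q'; have [->|q'q] := eqVneq q' q.
  by rewrite /w' hornerD hornerN !hornerM !hornerC hornerD hornerN !hornerM G0 P0; ring.
have := congr1 (fun f => f.[a q', b q']) E.
rewrite !(hornerD, hornerM, hornerC) w0 mulr0.
have -> : F.[a q', b q'] = 0.
  have [u [v [t Ft]]] := Fsing q'; rewrite -/(X q') -/(Y q') in Ft.
  by rewrite Ft horner_quad hornerC (XY0 q').2 horner_quad (XY0 q').1 horner0; ring.
rewrite mul0r addr0 => /esym/eqP; rewrite mulf_eq0 hornerX hornerN hornerC subr_eq0.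
by rewrite (inj_eq a_inj) (negPf q'q) => /eqP.
Qed.

Let D q := divdiff p (a q).

Let pX q : p = X q * D q.
Proof.
rewrite {1}(divdiffP p (a q)) -/(X q) (_ : p.[a q] = 0) ?addr0 //.
by rewrite /p (bigD1 q) //= hornerM (XY0 q).1 mul0r.
Qed.

Let H : {poly {poly k}} := \sum_q ((lam q)%:P * D q)%:P * G q.

Let H_step w : van w -> exists w' E, van w' /\ H * w = p%:P * w' + F * E.
Proof.
move=> w0; rewrite /H; elim/big_rec: _ => [|q h _ [w1 [E1 [w10 Ew1]]]].
  by exists 0, 0; split=> [q|]; rewrite ?horner0 ?mul0r ?mulr0 ?addr0.
have [w2 [E2 [w20 Ew2]]] := van_step q w0.
exists ((lam q)%:P%:P * w2 + w1), (((lam q)%:P * D q)%:P * E2 + E1); split.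
  by move=> q'; rewrite !(hornerD, hornerM, hornerC) w10 w20 mulr0 addr0.
rewrite mulrDl Ew1 -mulrA Ew2 (pX q) !polyCM; ring.
Qed.

(** As p itself vanishes at the points, H_step can be iterated from p. *)
Let H_iter r : exists w E, H ^+ r * p%:P = p%:P ^+ r * w + F * E.
Proof.
suff [w [E [_ EH]]] : exists w E, van w /\ H ^+ r * p%:P = p%:P ^+ r * w + F * E.
  by exists w, E.
elim: r => [|r [w [E [w0 EH]]]].
  exists p%:P, 0; split; last by rewrite !expr0 mulr0 addr0.
  by move=> q; rewrite hornerC (pX q) hornerM (XY0 q).1 mul0r.
have [w' [E' [w'0 EH']]] := H_step w0.
exists w', (p%:P ^+ r * E' + H * E); split=> //.
by rewrite exprS -mulrA EH mulrDr mulrCA EH' exprSr; ring.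
Qed.

Hypothesis lam0 : forall u v, (u + v <= d)%N -> \sum_q lam q * a q ^+ u * b q ^+ v = 0.

Let s := #|I|.

Let size_p : size p = s.+1.
Proof. by rewrite /p size_prod_XsubC /s cardE; congr (size _).+1; rewrite /index_enum -enumT. Qed.

(** Expanding the divided differences, the coefficient of each monomial of H
    contains one of the sums of lam0 unless its total degree is less than s: the
    top part of H is made of relations. *)
Let deg_H : deg_le s.-1 H.
Proof.
pose T q l v j u : {poly {poly k}} :=
  ((lam q * a q ^+ v * b q ^+ u)%:P * (p`_l)%:P * F`_j * 'X^(l.-1 - v))%:P *
     'X^(j.-1 - u).
have -> : H = \sum_(l < size p) \sum_(v < l) \sum_(j < size F) \sum_(u < j)
    \sum_q T q l v j u.
  transitivity (\sum_q \sum_(l < size p) \sum_(v < l) \sum_(j < size F)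
     \sum_(u < j) T q l v j u).
    apply: eq_bigr => q _.
    have -> : (lam q)%:P * D q = \sum_(l < size p) \sum_(v < l)
        (lam q * a q ^+ v)%:P * (p`_l)%:P * 'X^(l.-1 - v).
      rewrite mulr_sumr; apply: eq_bigr => l _; rewrite scaler_sumr mulr_sumr.
      by apply: eq_bigr => v _; rewrite -!mul_polyC !polyCM; ring.
    have -> : G q = \sum_(j < size F) \sum_(u < j)
        (F`_j * (b q ^+ u)%:P)%:P * 'X^(j.-1 - u).
      apply: eq_bigr => j _; rewrite scaler_sumr; apply: eq_bigr => u _.
      by rewrite -!mul_polyC !polyCM !polyC_exp mulrA.
    rewrite rmorph_sum mulr_suml; apply: eq_bigr => l _.
    rewrite rmorph_sum mulr_suml; apply: eq_bigr => v _.
    rewrite mulr_sumr; apply: eq_bigr => j _; rewrite mulr_sumr.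
    by apply: eq_bigr => u _; rewrite /T !polyCM; ring.
  rewrite exchange_big; apply: eq_bigr => l _.
  rewrite exchange_big; apply: eq_bigr => v _.
  by rewrite exchange_big; apply: eq_bigr => j _; rewrite exchange_big.
apply: deg_le_sum => l _; apply: deg_le_sum => v _.
apply: deg_le_sum => j _; apply: deg_le_sum => u _.
have -> : \sum_q T q l v j u =
   ((\sum_q lam q * a q ^+ v * b q ^+ u)%:P * (p`_l)%:P * F`_j * 'X^(l.-1 - v))%:P *
     'X^(j.-1 - u).
  by rewrite rmorph_sum !mulr_suml rmorph_sum mulr_suml.
case: (leqP (v + u) d) => [vu|vu].
  by rewrite lam0 // !(mul0r, polyC0); exact: deg_le0.
apply: deg_leCXn; have [->|Fj] := eqVneq F`_j 0.
  by rewrite mulr0 !mul0r size_poly0.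
rewrite -polyCM -!mulrA mul_polyC; apply: leq_trans (size_scale_leq _ _) _.
rewrite -exprD size_mulXn //; have := dF j; rewrite size_mulXn //.
have arith (m l' v' j' u' : nat) : (l' < s.+1 -> v' < l' -> u' < j' -> d < v' + u' ->
    j' + m <= d.+1 -> l'.-1 - v' + (j'.-1 - u') + m <= s.-1.+1)%N by clear; lia.
by apply: arith; rewrite -?size_p.
Qed.

Hypothesis d_gt0 : (0 < d)%N.

Let G_monic q : G q \is monic /\ size (G q) = d.
Proof.
have EF := divdiffP F (b q)%:P; rewrite -/(G q) -/(Y q) in EF.
have sYG : size (Y q * G q) = d.+1.
  have -> : Y q * G q = F - (F.[(b q)%:P])%:P by apply/eqP; rewrite eq_sym subr_eq; apply/eqP.
  by rewrite size_polyDl ?sF // size_polyN (leq_ltn_trans (size_polyC_leq1 _)).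
have G0 : G q != 0 by apply: contra_eq_neq sYG => ->; rewrite mulr0 size_poly0.
split; last first.
  by move: sYG; rewrite size_monicM ?monicXsubC // size_XsubC => - [].
rewrite -(monicMl _ (monicXsubC (b q)%:P)) -/(Y q).
move: Fm; rewrite !monicE {1}EF lead_coefDl // sYG.
by rewrite (leq_ltn_trans (size_polyC_leq1 _)).
Qed.

Let DE q : D q = \prod_(q' | q' != q) X q'.
Proof. by apply: (mulfI (X_neq0 q)); rewrite -pX /p (bigD1 q). Qed.

(** The coefficient of y^(d - 1) in H is sum_q lam q * D q, since each G q is
    monic of degree d - 1; its value at a q is a nonzero multiple of lam q. *)
Let H_neq0 q : lam q != 0 -> H != 0.
Proof.
apply: contraNneq => H0.
have : \sum_q (lam q)%:P * D q = 0.
  rewrite -[RHS](coef0 _ d.-1) -H0 /H coef_sum; apply: eq_bigr => q' _.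
  have [Gm' sG] := G_monic q'; rewrite coefCM.
  have -> : (G q')`_d.-1 = 1 by move: Gm'; rewrite monicE /lead_coef sG => /eqP.
  by rewrite mulr1.
move=> /(congr1 (horner^~ (a q))); rewrite horner0 horner_sum (bigD1 q) //=.
rewrite big1 => [|q' q'q]; last first.
  rewrite hornerM DE horner_prod (bigD1 q) 1?eq_sym //=.
  by rewrite (XY0 q).1 mul0r mulr0.
move=> /eqP; rewrite addr0 hornerM hornerC mulf_eq0 => /orP [/eqP //|].
rewrite DE horner_prod prodf_seq_eq0 => /hasP [q' _ /andP [q'q]].
by rewrite hornerXsubC subr_eq0 (inj_eq a_inj) eq_sym (negPf q'q).
Qed.

(** The uniqueness of the curve, for polynomials whose degree in y is too small
    to be nonzero multiples of F. *)
Hypothesis F_uniq : forall G, deg_le d G -> (size G <= d)%N ->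
  (forall x y, F.[x, y] = 0 -> G.[x, y] = 0) -> G = 0.

(** The remainder f of H ^ r * p modulo F has total degree at most
    r * (s - 1) + s, which is less than the degree r * s of p ^ r once r > s. But
    f = p ^ r * w' by H_iter, so f = 0; and p, being free of y, is prime to the
    monic F. *)
Let F_dvd_HX (q0 : I) : F %| H ^+ s.+1.
Proof.
have [w [E EH]] := H_iter s.+1.
have dHp : deg_le (s.-1 * s.+1 + s) (H ^+ s.+1 * p%:P).
  apply: deg_leM; first exact: deg_leX.
  by apply: deg_leC; rewrite size_p.
have [Q [f [Ef sf df]]] := deg_le_mod Fm sF dF dHp.
have wE := Pdiv.RingMonic.rdivp_eq Fm w.
set w' := Pdiv.Ring.rmodp w F in wE; set Q' := Pdiv.Ring.rdivp w F in wE.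
have sw' : (size w' <= d)%N by rewrite -ltnS -sF Pdiv.Ring.ltn_rmodpN0 ?monic_neq0.
have pm : p \is monic by rewrite monic_prod_XsubC.
have fw : f = p%:P ^+ s.+1 * w'.
  apply/eqP; rewrite -subr_eq0.
  have EZ : f - p%:P ^+ s.+1 * w' = F * (p%:P ^+ s.+1 * Q' + E - Q).
    have -> : f = H ^+ s.+1 * p%:P - F * Q by rewrite Ef addrC addKr.
    by rewrite EH {1}wE; ring.
  apply: contraT => Z0.
  have : (d < size (f - p%:P ^+ s.+1 * w')%R)%N.
    move: Z0; rewrite EZ => Z0; rewrite size_monicM // ?sF.
      have : p%:P ^+ s.+1 * Q' + E - Q != 0 by apply: contraNneq Z0 => ->; rewrite mulr0.
      by rewrite -size_poly_gt0; case: (size _) => // m _; rewrite addnS ltnS leq_addr.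
    by apply: contraNneq Z0 => ->; rewrite mulr0.
  rewrite ltnNge (leq_trans (size_polyD _ _)) // size_polyN geq_max sf /=.
  by rewrite -rmorphXn mul_polyC (leq_trans (size_scale_leq _ _)).
have w'0 : w' = 0.
  apply/polyP => j; rewrite coef0; apply/eqP; apply: contraT => wj.
  have := df j; rewrite fw -rmorphXn coefCM -mulrA size_monicM ?monic_exp //; last first.
    by rewrite mulf_neq0 // expf_neq0 // polyX_eq0.
  rewrite size_mulXn // -[size (p ^+ _)]prednK; last first.
    by rewrite size_poly_gt0 monic_neq0 // monic_exp.
  rewrite size_exp size_p /=; move: wj; rewrite -size_poly_gt0.
  have s0 : (0 < s)%N by apply/card_gt0P; exists q0.
  move: (size _) => m; rewrite -[in (s * _)%N](prednK s0) mulSn; clear; lia.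
have HF : p *: H ^+ s.+1 = Q * F.
  by rewrite -mul_polyC mulrC Ef fw w'0 mulr0 addr0 mulrC.
by rewrite -(@dvdpZr _ p) ?monic_neq0 // HF dvdp_mull.
Qed.

(** By F_dvd_HX every irreducible factor of F divides H, which has degree less
    than d in y. So if H is not 0 then gcd(F, H), made a divisor of F in k[x][y]
    by Gauss's lemma, has the same zeros as F and contradicts F_uniq. *)
Lemma affine_double_points_independent q : lam q = 0.
Proof.
apply: contraTeq isT => /H_neq0 H0; apply/negP => _.
have F0 : F != 0 by rewrite monic_neq0.
pose g := gcdp F H.
have Fg : F %| g ^+ s.+1.
  have [[u v] /= uvg] := Bezoutp F H.
  rewrite -(eqp_dvdr _ (eqp_exp s.+1 uvg)) addrC exprDn.
  rewrite big_ord_recl subn0 expr0 mulr1 mulr1n dvdp_add //.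
    by rewrite exprMn dvdp_mull // F_dvd_HX.
  apply: (big_ind (fun h => F %| h)) => [|h1 h2|i _]; first exact: dvdp0.
    exact: dvdp_add.
  by rewrite -mulr_natr dvdp_mulr // dvdp_mull // exprS dvdp_mulr // dvdp_mull.
have := dvdp_gcdl F H; rewrite -/g Pdiv.Idomain.dvdp_eq => /eqP.
set c := _ ^+ _; move=> Ec.
have g0 : g != 0 by rewrite gcdp_eq0 (negPf F0).
have c0 : c != 0 by rewrite expf_neq0 // lead_coef_eq0.
have [G' [E' [EF G'g]]] := gauss_split c0 (etrans Ec (mulrC _ _)).
have E'0 : E' != 0 by apply: contraNneq F0 => E0; rewrite EF E0 mulr0.
suff G'0 : G' = 0 by move: F0; rewrite EF G'0 mul0r eqxx.
apply: F_uniq.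
- by apply: (deg_le_divisor E'0); rewrite -EF.
- rewrite (eqp_size G'g) (leq_trans (leq_gcdpr _ H0)) // /H.
  apply: leq_trans (size_sum _ _ _) _; apply/bigmax_leqP => q' _.
  by rewrite mul_polyC (leq_trans (size_scale_leq _ _)) // (G_monic q').2.
have /(Pdiv.IdomainMonic.dvdpP Fm) [Q EQ] : F %| G' ^+ s.+1.
  by rewrite (eqp_dvdr _ (eqp_exp s.+1 G'g)).
move=> x y Fxy; have := congr1 (fun f => f.[x, y]) EQ.
rewrite hornerM hornerM Fxy mulr0 !horner_exp => /eqP.
by rewrite expf_eq0 => /andP [_ /eqP].
Qed.

End AffineCurve.

(** * Affine coordinates on the projective plane *)

Lemma meval_scale n (R : comNzRingType) d (f : {mpoly R[n]}) (c : R) v :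
  f \is d.-homog -> f.@[fun j => c * v j] = c ^+ d * f.@[v].
Proof.
move=> /dhomogP fd; rewrite !mevalE big_seq [in RHS]big_seq mulr_sumr.
apply: eq_bigr => m /fd Em; rewrite mulrCA; congr (_ * _).
have -> : d = (\sum_j m j)%N by rewrite -mdegE -Em.
by rewrite -prodrXr -big_split; apply: eq_bigr => j _; rewrite exprMn.
Qed.

Lemma mderiv_homog n (R : comNzRingType) d (f : {mpoly R[n]}) j :
  f \is d.-homog -> f^`M(j) \is d.-1.-homog.
Proof.
move=> /dhomogP fd; apply/dhomogP => m; rewrite mcoeff_msupp mcoeff_deriv => fm.
have Ed : mdeg (m + U_(j)) = d.
  by apply: fd; rewrite mcoeff_msupp; apply: contraNneq fm => ->; rewrite mul0rn.
by rewrite -Ed mdegD mdeg1 addn1.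
Qed.

Definition linform (k : comNzRingType) n (L : 'cV[k]_n) : {mpoly k[n]} :=
  \sum_j L j 0 *: 'X_j.

Lemma linform_eval (k : comNzRingType) n (L : 'cV[k]_n) v :
  (linform L).@[v] = \sum_j v j * L j 0.
Proof.
rewrite /linform raddf_sum; apply: eq_bigr => j _ /=.
by rewrite mevalZ mevalXU mulrC.
Qed.

Lemma linform_rV (k : comNzRingType) n (L : 'cV[k]_n) (v : 'rV_n) :
  (linform L).@[v 0] = (v *m L) 0 0.
Proof. by rewrite linform_eval mxE. Qed.

Lemma linform_neq0 (k : comNzRingType) n (L : 'cV[k]_n) : L != 0 -> linform L != 0.
Proof.
apply: contraNneq => L0; apply/eqP/matrixP => i j; rewrite ord1 mxE.
have := congr1 (mcoeff U_(i)) L0; rewrite mcoeff0 raddf_sum (bigD1 i) //= big1.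
  by rewrite mcoeffZ mcoeffXU eqxx mulr1 addr0.
by move=> l li; rewrite mcoeffZ mcoeffXU (negPf li) mulr0.
Qed.

Lemma linform_homog (k : comNzRingType) n (L : 'cV[k]_n) : linform L \is 1.-homog.
Proof.
by apply: rpred_sum => j _; apply: dhomogZ; rewrite dhomogX; apply/eqP/mdeg1.
Qed.

Lemma generic_rV (k : fieldType) (hk : [pchar k] =i pred0) n (I : finType)
    (f : I -> {mpoly k[n]}) :
  (forall i, f i != 0) -> exists v : 'rV[k]_n, forall i, (f i).@[v 0] != 0.
Proof.
move=> f0; have /(mpoly_nonroot hk) [v] : \prod_i f i != 0.
  by apply/prodf_neq0 => i _.
rewrite rmorph_prod => /prodf_neq0 vf; exists (\row_j v j) => i.
by rewrite (@meval_eq _ _ _ v) ?vf // => j; rewrite mxE.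
Qed.

Lemma big_ord3 (V : nmodType) (F : 'I_3 -> V) : \sum_j F j = F 0 + F 1 + F 2%:R.
Proof.
rewrite !big_ord_recl big_ord0 addr0 addrA.
by congr (F _ + F _ + F _); apply: val_inj.
Qed.

(** The line Z through e is going to be the line at infinity of an affine plane
    in which e is the direction of the y-axis. *)
Lemma frame_complete (k : fieldType) (e : 'rV[k]_3) (Z : 'cV[k]_3) : e != 0 -> Z != 0 ->
  e *m Z = 0 -> exists U : 'M[k]_3, [/\ U \in unitmx, row 1 U = e,
     (row 0 U) *m Z = 0 & (row 2%:R U *m Z) = 1].
Proof.
move=> e0 Z0 eZ.
have [l Zl] : exists l, Z l 0 != 0.
  apply/existsP; apply: contraNT Z0; rewrite negb_exists => /forallP Z0.
  by apply/eqP/matrixP => i j; rewrite ord1 mxE; apply/eqP; have := Z0 i; rewrite negbK.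
have eK : (e <= kermx Z)%MS by apply/sub_kermxP.
have /row_subPn [i ui] : ~~ (kermx Z <= e)%MS.
  apply: contraTN isT => /mxrankS; rewrite mxrank_ker rank_rV e0 -mxrank_tr rank_rV.
  by rewrite trmx_eq0 Z0.
pose u0 := row i (kermx Z).
have u0Z : u0 *m Z = 0 by rewrite -row_mul mulmx_ker row0.
pose u2 : 'rV[k]_3 := (Z l 0)^-1 *: delta_mx 0 l.
have u2Z : u2 *m Z = 1.
  rewrite -scalemxAl -rowE; apply/matrixP => ? ?; rewrite !ord1 !mxE.
  by rewrite mulVf.
have {}ui : ~~ (u0 <= e)%MS by [].
clearbody u0 u2; pose U : 'M[k]_3 := \matrix_(a < 3) (if a == 0 then u0 else if a == 1 then e else u2).
have U0 : row 0 U = u0 by rewrite rowK.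
have U1 : row 1 U = e by rewrite rowK.
have U2 : row 2%:R U = u2 by rewrite rowK.
exists U; rewrite U0 U1 U2; split=> //.
rewrite -row_free_unit -kermx_eq0; apply/rowV0P => w /sub_kermxP.
rewrite mulmx_sum_row big_ord3 U0 U1 U2 => Ew.
have w2 : w 0 2%:R = 0.
  have /= := congr1 (mulmx^~ Z) Ew; rewrite !mulmxDl mul0mx -!scalemxAl u0Z eZ u2Z.
  by rewrite !scaler0 !add0r => /matrixP/(_ 0 0); rewrite !mxE mulr1.
move: Ew; rewrite w2 scale0r addr0 => Ew.
have w0 : w 0 0 = 0.
  apply: contraNeq ui => w0; apply/sub_rVP.
  exists (- (w 0 0)^-1 * w 0 1).
  apply: (scalerI w0); rewrite scalerA mulNr mulrN mulVKf // scaleNr.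
  by apply/eqP; rewrite -addr_eq0 Ew.
move: Ew; rewrite w0 scale0r add0r => /eqP; rewrite scaler_eq0 (negPf e0) orbF => /eqP w1.
apply/rowP => j; rewrite mxE; case: j => -[|[|[|//]]] hj.
- by rewrite -w0; congr (w _ _); apply: val_inj.
- by rewrite -w1; congr (w _ _); apply: val_inj.
- by rewrite -w2; congr (w _ _); apply: val_inj.
Qed.

Lemma deg_le_size (k : fieldType) d (f : {poly {poly k}}) : deg_le d f -> (size f <= d.+1)%N.
Proof.
move=> fd; apply/leq_sizeP => j dj; apply/eqP; apply: contraT => fj.
have := fd j; rewrite size_mulXn //; move: fj; rewrite -size_poly_gt0.
by move: (size _) => m; lia.
Qed.

Lemma coefM_top (R : nzRingType) (f g : {poly R}) a b :
  (size f <= a.+1)%N -> (size g <= b.+1)%N -> (f * g)`_(a + b) = f`_a * g`_b.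
Proof.
move=> fa gb; have la : (a < (a + b).+1)%N by rewrite ltnS leq_addr.
rewrite coefM (bigD1 (Ordinal la)) //= addKn big1 ?addr0 // => i.
rewrite -val_eqE /= neq_ltn => /orP [ia|ai].
  rewrite [g`__]nth_default ?mulr0 // (leq_trans gb) //; lia.
by rewrite nth_default ?mul0r // (leq_trans fa).
Qed.

(** The rows of U are the points at infinity on
    the x-axis and on the y-axis, and the origin of the affine plane. *)
Section Dehomogenization.
Variables (k : fieldType) (U : 'M[k]_3).
Hypothesis Uu : U \in unitmx.

Definition affine_pt (a b : k) : 'rV[k]_3 :=
  a *: row 0 U + b *: row 1 U + row 2%:R U.

Definition affine_coord (x y : {poly {poly k}}) (j : 'I_3) : {poly {poly k}} :=
  x * (U 0 j)%:P%:P + y * (U 1 j)%:P%:P + (U 2%:R j)%:P%:P.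

Definition dehom (f : {mpoly k[3]}) : {poly {poly k}} :=
  mmap (polyC \o polyC) (affine_coord 'X%:P 'X) f.

Lemma dehomE f a b : (dehom f).[b%:P].[a] = f.@[affine_pt a b 0].
Proof.
rewrite /dehom; elim/mpoly_ring_ind: f => [c|j|g h Eg Eh|g h Eg Eh].
- by rewrite mmapC mevalC /= !hornerC.
- by rewrite mmapX mmap1U mevalXU /affine_coord /affine_pt !mxE !hornerE.
- by rewrite mmapD mevalD !hornerD Eg Eh.
- by rewrite rmorphM mevalM !hornerM Eg Eh.
Qed.

Lemma affine_coord_deg j : deg_le 1 (affine_coord 'X%:P 'X j).
Proof.
rewrite /affine_coord; apply: deg_leD; first apply: deg_leD.
- rewrite -polyCM; apply: deg_leC; rewrite mulrC mul_polyC.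
  by rewrite (leq_trans (size_scale_leq _ _)) // size_polyX.
- rewrite mulrC -['X]expr1; apply: deg_leCXn; rewrite mul_polyC expr1.
  by rewrite (leq_trans (size_scale_leq _ _)) // size_polyX.
by apply: deg_leC; rewrite (leq_trans (size_polyC_leq1 _)).
Qed.

Lemma dehom_deg d f : f \is d.-homog -> deg_le d (dehom f).
Proof.
move=> /dhomogP fd; rewrite /dehom /mmap big_seq; apply: deg_le_sum => m mf.
rewrite -(fd m mf) -[X in deg_le X](add0n); apply: deg_leM.
  by apply: deg_leC; rewrite (leq_trans (size_polyC_leq1 _)).
rewrite /mmap1; change (deg_le (mdeg m) (\prod_(i < 3) affine_coord 'X%:P 'X i ^+ m i)).
rewrite mdegE.
elim/big_ind2: _ => [|D g E h gD hE|j _].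
- by rewrite -[1](expr0 0); apply: (@deg_leX _ 0 0 0); exact: deg_le0.
- exact: deg_leM.
by rewrite -[X in deg_le X]mul1n; apply: deg_leX; exact: affine_coord_deg.
Qed.

(** The coefficient of y^d is the value of f at the point at infinity of the
    y-axis; so dehom f is monic in y, up to a scalar, when this point is not on
    the curve f. *)
Lemma dehom_top d f : f \is d.-homog -> (dehom f)`_d = (f.@[U 1])%:P.
Proof.
move=> /dhomogP fd; rewrite /dehom mevalE /mmap big_seq [in RHS]big_seq.
rewrite coef_sum rmorph_sum; apply: eq_bigr => m mf /=.
rewrite coefCM polyCM; congr (_ * _).
have -> : d = (\sum_j m j)%N by rewrite -mdegE -(fd m mf).
pose h j := affine_coord 'X%:P 'X j ^+ m j.
suff [] : (size (\prod_j h j)%R <= (\sum_j m j).+1)%N /\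
   (\prod_j h j)`_(\sum_j m j) = (\prod_i U 1 i ^+ m i)%:P by [].
elim/big_rec3: _ => [|j D g v _ [sg Eg]]; first by rewrite size_poly1 coef1.
have [sh Eh] : (size (h j) <= (m j).+1)%N /\ (h j)`_(m j) = (U 1 j ^+ m j)%:P.
  rewrite /h; elim: (m j) => [|e [se Ee]]; first by rewrite size_poly1 coef1.
  have s1 := deg_le_size (affine_coord_deg j).
  split; first by rewrite exprS (leq_trans (size_polyMleq _ _)) //; lia.
  rewrite exprS -add1n coefM_top // Ee exprS polyCM; congr (_ * _).
  by rewrite /affine_coord !coefD !coefMC coefX !coefC /= mul0r add0r mul1r addr0.
split; first by rewrite (leq_trans (size_polyMleq _ _)) //; lia.
by rewrite coefM_top // Eh Eg polyCM.
Qed.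

Let nthU (a b c : k) (j : 'I_3) := if j == 0 then a else if j == 1 then b else c.

(** The coordinate functions of the frame U. *)
Definition cform (j : 'I_3) : {mpoly k[3]} := linform (col j (invmx U)).

Lemma cform_pt j a b c : (cform j).@[(c *: affine_pt a b) 0] =
  c * (if j == 0 then a else if j == 1 then b else 1).
Proof.
rewrite linform_rV -scalemxAl mxE; congr (_ * _).
have -> : affine_pt a b = (\row_l nthU a b 1 l) *m U.
  by rewrite mulmx_sum_row big_ord3 !mxE /= /affine_pt scale1r.
by rewrite colE !mulmxA mulmxK // -colE !mxE.
Qed.

Lemma dehom_cform j :
  dehom (cform j) = if j == 0 then 'X%:P else if j == 1 then 'X else 1.
Proof.
have E i : (\sum_l (invmx U) l j * U i l) = (i == j)%:R.
  have /matrixP/(_ i j) := mulmxV Uu; rewrite !mxE => <-.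
  by apply: eq_bigr => l _; rewrite mulrC.
have -> : dehom (cform j) = 'X%:P * (0 == j)%:R%:P%:P + 'X * (1 == j)%:R%:P%:P
    + (2%:R == j)%:R%:P%:P.
  rewrite -!E !rmorph_sum !mulr_sumr -!big_split /cform /linform.
  rewrite /dehom raddf_sum; apply: eq_bigr => l _ /=.
  by rewrite mmapZ mmapX mmap1U !mxE /affine_coord !polyCM /=; ring.
case: j {E} => -[|[|[|//]]] hj; rewrite -!val_eqE /=.
- by rewrite !polyC1 !polyC0; ring.
- by rewrite !polyC1 !polyC0; ring.
by rewrite !polyC1 !polyC0; ring.
Qed.

Definition rehom d (G : {poly {poly k}}) : {mpoly k[3]} :=
  \sum_(j < d.+1) \sum_(i < d.+1 | (i + j <= d)%N)
     G`_j`_i *: (cform 0 ^+ i * cform 1 ^+ j * cform 2%:R ^+ (d - (i + j))).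

Lemma rehom_homog d G : rehom d G \is d.-homog.
Proof.
apply: rpred_sum => j _; apply: rpred_sum => i ij; apply: dhomogZ.
have : cform 0 ^+ i * cform 1 ^+ j * cform 2%:R ^+ (d - (i + j))
    \is (1 * i + 1 * j + 1 * (d - (i + j))).-homog.
  by do ![apply: dhomogM | apply: dhomogMn | apply: linform_homog].
by rewrite !mul1n subnKC.
Qed.

(** A polynomial of total degree at most d is the sum of its monomials x^i y^j
    with i + j <= d, and cform 0, cform 1, cform 2 dehomogenize to x, y, 1. *)
Lemma rehomK d G : deg_le d G -> dehom (rehom d G) = G.
Proof.
move=> Gd; rewrite /rehom /dehom raddf_sum -[RHS]coefK.
rewrite poly_def (big_ord_widen d.+1 (fun j => G`_j *: 'X^j)) ?deg_le_size //.
rewrite [RHS]big_mkcond; apply: eq_bigr => j _ /=; case: ltnP => [jG|Gj]; last first.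
  by rewrite nth_default // big1 ?mmap0 // => i _; rewrite coef0 scale0r.
have Gj0 i : (d < i + j)%N -> G`_j`_i = 0.
  move=> dij; have [->|Gj0] := eqVneq G`_j 0; first by rewrite coef0.
  rewrite nth_default //; have := Gd j; rewrite size_mulXn //.
  by move: dij; move: (size _) => m; clear; lia.
rewrite raddf_sum -mul_polyC -{2}[G`_j]coefK poly_def rmorph_sum mulr_suml /=.
rewrite (big_ord_widen d.+1 (fun i => (G`_j`_i *: 'X^i)%:P * 'X^j : {poly {poly k}})).
  rewrite big_mkcond [RHS]big_mkcond; apply: eq_bigr => i _ /=.
  case: (leqP (i + j) d) => ij; last first.
    by rewrite (Gj0 _ ij) scale0r polyC0 mul0r; case: ifP.
  rewrite mmapZ !rmorphM !rmorphXn /= -!/(dehom _) !dehom_cform /=.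
  rewrite expr1n mulr1 mulrA -mul_polyC polyCM polyC_exp.
  by case: ltnP => // ?; rewrite nth_default // !polyC0 !mul0r.
have := Gd j; have [->|Gj1] := eqVneq G`_j 0; first by rewrite size_poly0.
rewrite size_mulXn //; apply: leq_trans; exact: leq_addl.
Qed.

Lemma rehom_pt d G a b c : deg_le d G ->
  (rehom d G).@[(c *: affine_pt a b) 0] = c ^+ d * G.[b%:P].[a].
Proof.
move=> Gd; rewrite -{2}(rehomK Gd) dehomE -(meval_scale _ _ (rehom_homog d G)).
by apply: meval_eq => j; rewrite !mxE.
Qed.

End Dehomogenization.

(** * Singular points of the unique curve impose independent conditions *)

(** Expand f at the point to first order; the quadratic remainder is in the
    square of the ideal of the affine point. *)
Lemma dehom_double (k : fieldType) (U : 'M[k]_3) (f : {mpoly k[3]}) a b :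
    f.@[affine_pt U a b 0] = 0 ->
    (forall j, f^`M(j).@[affine_pt U a b 0] = 0) ->
  double_pt (dehom U f) a b.
Proof.
move=> f0 df0; pose X : {poly {poly k}} := ('X - a%:P)%:P.
pose Y : {poly {poly k}} := 'X - (b%:P)%:P.
pose x j : {poly {poly k}} := (affine_pt U a b 0 j)%:P%:P.
pose y j : {poly {poly k}} := X * (U 0 j)%:P%:P + Y * (U 1 j)%:P%:P.
have Exy j : affine_coord U 'X%:P 'X j = x j + y j.
  by rewrite /affine_coord /x /y /X /Y !mxE !(polyCD, polyCM, polyCN, polyCB); ring.
have [z [r ->] Ez] := mmap_taylor (polyC \o polyC : {rmorphism k -> {poly {poly k}}}) x y f.
have mx (g : {mpoly k[3]}) : mmap (polyC \o polyC) x g = (g.@[affine_pt U a b 0])%:P%:P.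
  rewrite mevalE !rmorph_sum; apply: eq_bigr => m _.
  rewrite !rmorphM !rmorph_prod; congr (_ * _).
  by apply: eq_bigr => j _; rewrite !rmorphXn.
rewrite mx f0 !polyC0 add0r big1 ?add0r in Ez; last first.
  by move=> j _; rewrite mx df0 !polyC0 mul0r.
have {Ez} -> : dehom U f = \sum_i \sum_j r i j * (y i * y j).
  rewrite -Ez; apply: eq_bigr => m _; congr (_ * _).
  by apply: mmap1_eq => j; rewrite Exy.
exists (\sum_i \sum_j r i j * ((U 0 i)%:P%:P * (U 0 j)%:P%:P)).
exists (\sum_i \sum_j r i j *
  ((U 0 i)%:P%:P * (U 1 j)%:P%:P + (U 1 i)%:P%:P * (U 0 j)%:P%:P)).
exists (\sum_i \sum_j r i j * ((U 1 i)%:P%:P * (U 1 j)%:P%:P)).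
rewrite -/X -/Y !mulr_sumr -!big_split; apply: eq_bigr => i _.
rewrite !mulr_sumr -!big_split; apply: eq_bigr => j _ /=.
by rewrite /y; ring.
Qed.

Definition common_line (k : fieldType) (v w : 'rV[k]_3) : 'cV[k]_3 :=
  (nz_row (kermx (row_mx v^T w^T)))^T.

Lemma common_lineP (k : fieldType) (v w : 'rV[k]_3) :
  [/\ common_line v w != 0, v *m common_line v w = 0 & w *m common_line v w = 0].
Proof.
rewrite /common_line trmx_eq0 nz_row_eq0.
have : nz_row (kermx (row_mx v^T w^T)) *m row_mx v^T w^T = 0.
  by apply/sub_kermxP/nz_row_sub.
rewrite mul_mx_row => /eqP; rewrite -row_mx0 => /eqP/eq_row_mx [nv nw].
split; try by apply: trmx_inj; rewrite trmx_mul trmxK trmx0.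
rewrite -mxrank_eq0 mxrank_ker subn_eq0 -ltnNge.
by rewrite (leq_ltn_trans (rank_leq_col _)).
Qed.

(** The coefficients kap form a relation, between the values of all forms of
    degree d, that is supported on distinct singular points of the unique curve
    C of degree d through the points v. *)
Section SingularPoints.
Variables (k : fieldType) (hk : [pchar k] =i pred0) (d n : nat).
Variables (v : 'I_n -> 'rV[k]_3) (C : {mpoly k[3]}) (kap : 'I_n -> k).
Hypotheses (d_gt0 : (0 < d)%N) (Cd : C \is d.-homog) (C0 : C != 0).
Hypotheses (v0 : forall i, v i != 0) (Cv : forall i, C.@[v i 0] = 0).
Hypothesis Cuniq : forall D : {mpoly k[3]}, D \is d.-homog ->
  (forall i, D.@[v i 0] = 0) -> exists c, D = c *: C.

(** The point e at infinity on the y-axis is off C and off the lines joining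
    two of the points, so that distinct points have distinct x-coordinates; the
    line at infinity passes through e and through none of the points. Finitely
    many nonzero polynomials have to be avoided, which is possible in
    characteristic 0. *)
Lemma good_frame (i0 : 'I_n) : exists U : 'M[k]_3, [/\ U \in unitmx, C.@[U 1] != 0,
  forall i, exists a b c : k, c != 0 /\ v i = c *: affine_pt U a b &
  forall i j (a c b b' c' : k), c != 0 -> v i = c *: affine_pt U a b ->
     v j = c' *: affine_pt U a b' -> (v j <= v i)%MS].
Proof.
pose f (o : option ('I_n * 'I_n)) : {mpoly k[3]} :=
  if o is Some (i, j) then linform (common_line (v i) (v j)) else C.
have [|e fe] := @generic_rV k hk _ _ f.
  by case=> [[i j]|] //=; apply: linform_neq0; case: (common_lineP (v i) (v j)).
have Ce : C.@[e 0] != 0 := fe None.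
have Le i j : (e *m common_line (v i) (v j)) 0 0 != 0.
  by rewrite -linform_rV; exact: fe (Some (i, j)).
have e0 : e != 0.
  apply: contraNneq Ce => ->; rewrite (_ : C.@[_] = C.@[fun j => 0 * (0 : 'rV[k]_3) 0 j]).
    by rewrite (meval_scale _ _ Cd) expr0n gtn_eqF ?mul0r.
  by apply: meval_eq => j; rewrite mul0r mxE.
have ve i : ~~ (v i <= e)%MS.
  apply/negP => /sub_rVP [c Ev]; have := Cv i.
  rewrite (_ : C.@[_] = C.@[fun j => c * e 0 j]); last first.
    by apply: meval_eq => j; rewrite Ev mxE.
  rewrite (meval_scale _ _ Cd) => /eqP; rewrite mulf_eq0 (negPf Ce) orbF expf_eq0.
  by case/andP => _ /eqP c0; have := v0 i; rewrite Ev c0 scale0r eqxx.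
have [|z hz] := @generic_rV k hk _ _ (fun i => linform (v i *m cokermx e)^T).
  by move=> i; apply: linform_neq0; rewrite trmx_eq0; have := ve i; rewrite submxE.
pose Z := cokermx e *m z^T.
have vZ i : (v i *m Z) 0 0 != 0.
  have := hz i; rewrite linform_rV; congr (_ != 0).
  have -> : z *m (v i *m cokermx e)^T = (v i *m Z)^T.
    by rewrite /Z mulmxA [RHS]trmx_mul trmxK.
  by rewrite mxE.
have eZ : e *m Z = 0 by rewrite /Z mulmxA mulmx_coker mul0mx.
have Z0 : Z != 0 by apply: contraNneq (vZ i0) => ->; rewrite mulmx0 mxE.
have [U [Uu U1 U0Z U2Z]] := frame_complete e0 Z0 eZ.
exists U; split=> //.
- by rewrite (@meval_eq _ _ _ (e 0)) // => j; rewrite -U1 mxE.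
- move=> i; pose c := (v i *m Z) 0 0; pose w := v i *m invmx U.
  have Ev : v i = w 0 0 *: row 0 U + w 0 1 *: row 1 U + w 0 2%:R *: row 2%:R U.
    by rewrite -{1}[v i](mulmxKV Uu) mulmx_sum_row big_ord3.
  have Ec : c = w 0 2%:R.
    rewrite /c Ev U1 !mulmxDl -!scalemxAl U0Z eZ U2Z !scaler0 !add0r.
    by rewrite !mxE mulr1.
  exists (w 0 0 / c), (w 0 1 / c), c; split; first exact: vZ.
  rewrite /affine_pt !scalerDr !scalerA ![c * _]mulrC !divfK ?vZ //.
  by rewrite {1}Ev Ec.
move=> i j a c b b' c' c0 Ei Ej.
have [_ Li Lj] := common_lineP (v i) (v j).
have E : c *: v j - c' *: v i = (c * c' * (b' - b)) *: e.
  rewrite Ei Ej /affine_pt U1; apply/rowP => l; rewrite !mxE; ring.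
have : (c * c' * (b' - b)) *: (e *m common_line (v i) (v j)) = 0.
  by rewrite scalemxAl -E mulmxBl -!scalemxAl Li Lj !scaler0 subrr.
move=> /matrixP/(_ 0 0); rewrite mxE [RHS]mxE => /eqP.
rewrite mulf_eq0 (negPf (Le i j)) orbF => /eqP z0.
apply/sub_rVP; exists (c^-1 * c'); apply: (scalerI c0).
rewrite scalerA mulVKf //; apply/eqP; rewrite -subr_eq0 E z0 scale0r eqxx //.
Qed.

Hypothesis ksing : forall i, kap i != 0 -> forall j, C^`M(j).@[v i 0] = 0.
Hypothesis kdist : forall i j, i != j -> kap i != 0 -> kap j != 0 ->
  ~~ (v j <= v i)%MS.
Hypothesis krel : forall f : {mpoly k[3]}, f \is d.-homog ->
  \sum_i kap i * f.@[v i 0] = 0.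

(** In the frame of good_frame the dehomogenized curve is monic in y, and
    affine_double_points_independent applies to the points with a nonzero
    coefficient. The relation has to be rescaled by c i ^ d, as v i is c i times
    its affine representative. *)
Theorem singular_points_independent i : kap i = 0.
Proof.
have [U [Uu CU vU vinj]] := good_frame i.
pose A := [set i | kap i != 0].
have /fin_all_exists [abc Habc] : forall i, exists abc : k * k * k,
   abc.2 != 0 /\ v i = abc.2 *: affine_pt U abc.1.1 abc.1.2.
  by move=> i'; have [a [b [c ?]]] := vU i'; exists (a, b, c).
pose a i := (abc i).1.1; pose b i := (abc i).1.2; pose c i := (abc i).2.
have c0 i' : c i' != 0 := (Habc i').1.
have vE i' : v i' = c i' *: affine_pt U (a i') (b i') := (Habc i').2.
pose C' := (C.@[U 1])^-1 *: C.
have C'd : C' \is d.-homog by apply: dhomogZ.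
have evC' w : C'.@[w] = (C.@[U 1])^-1 * C.@[w] := mevalZ w _ C.
have evdC' j w : C'^`M(j).@[w] = (C.@[U 1])^-1 * C^`M(j).@[w].
  by rewrite /C' mderivZ; exact: mevalZ.
pose F := dehom U C'.
have Fd := dehom_deg U C'd; rewrite -/F in Fd.
have Ftop : F`_d = 1.
  transitivity (C'.@[U 1])%:P; first exact: dehom_top.
  by rewrite evC' mulVf.
have sF : size F = d.+1.
  apply/eqP; rewrite eqn_leq deg_le_size //= ltnNge; apply/negP => /leq_sizeP/(_ d (leqnn d)).
  by rewrite Ftop => /eqP; rewrite oner_eq0.
have Fm : F \is monic by rewrite monicE /lead_coef sF /= Ftop.
have evv (f : {mpoly k[3]}) e i' : f \is e.-homog ->
    f.@[v i' 0] = c i' ^+ e * f.@[affine_pt U (a i') (b i') 0].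
  by move=> fe; rewrite -(meval_scale _ _ fe); apply: meval_eq => j; rewrite vE mxE.
have evZ (f : {mpoly k[3]}) e i' : f \is e.-homog -> f.@[v i' 0] = 0 ->
    f.@[affine_pt U (a i') (b i') 0] = 0.
  move=> /evv -> /eqP; rewrite mulf_eq0 expf_eq0 (negPf (c0 _)) andbF.
  by move/eqP.
pose h (q : 'I_#|A|) := enum_val q.
have hA q : kap (h q) != 0 by have := enum_valP q; rewrite inE.
have ainj : injective (a \o h).
  move=> q q' /= aq; apply/eqP; apply: contraT => qq'.
  have hh : h q != h q' by rewrite (inj_eq enum_val_inj).
  have := kdist hh (hA q) (hA q').
  have Ej := vE (h q'); rewrite -aq in Ej.
  by rewrite (vinj _ _ _ _ _ _ _ (c0 _) (vE (h q)) Ej).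
have Fs q : double_pt F (a (h q)) (b (h q)).
  apply: dehom_double => [|j].
    by rewrite evC' (evZ _ _ _ Cd) ?mulr0 ?Cv.
  by rewrite evdC' (evZ _ _ _ (mderiv_homog j Cd)) ?mulr0 ?ksing.
have lam0 u w : (u + w <= d)%N ->
    \sum_q (kap (h q) * c (h q) ^+ d) * a (h q) ^+ u * b (h q) ^+ w = 0.
  move=> uw.
  pose f := cform U 0 ^+ u * cform U 1 ^+ w * cform U 2%:R ^+ (d - (u + w)).
  have fd : f \is d.-homog.
    have : f \is (1 * u + 1 * w + 1 * (d - (u + w))).-homog.
      by do ![apply: dhomogM | apply: dhomogMn | apply: linform_homog].
    by rewrite !mul1n subnKC.
  have := krel fd; rewrite (bigID [pred i | i \in A]) /= [X in _ + X]big1 => [|i']; last first.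
    by rewrite inE negbK => /eqP ->; rewrite mul0r.
  rewrite addr0 big_enum_val => E; rewrite -[RHS]E; apply: eq_bigr => q _.
  rewrite vE /f !(mevalM, rmorphXn) /= !cform_pt //=.
  rewrite mulr1 !exprMn -[in LHS](subnKC uw) !exprD; ring.
have Fu G : deg_le d G -> (size G <= d)%N ->
    (forall x y, F.[y%:P].[x] = 0 -> G.[y%:P].[x] = 0) -> G = 0.
  move=> Gd sG Gv.
  have [|e Ee] := Cuniq (rehom_homog U d G).
    move=> i'; rewrite vE rehom_pt // Gv ?mulr0 //.
    by rewrite /F dehomE evC' (evZ _ _ _ Cd) ?mulr0 ?Cv.
  have EG : G = (e * C.@[U 1])%:P%:P * F.
    rewrite -(rehomK Uu Gd) Ee /F /C' /dehom !mmapZ /= mulrA -!polyCM.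
    by rewrite mulfK.
  suff e0 : e * C.@[U 1] = 0 by rewrite EG e0 !polyC0 mul0r.
  have := leq_sizeP _ _ sG d (leqnn d); rewrite EG coefCM Ftop mulr1.
  by move=> /eqP; rewrite polyC_eq0 => /eqP.
have Z q := affine_double_points_independent Fm sF Fd ainj Fs lam0 d_gt0 Fu q.
apply/eqP; apply: contraT => ki; have iA : i \in A by rewrite inE.
have := Z (enum_rank_in iA i); rewrite /h enum_rankK_in // => /eqP.
by rewrite mulf_eq0 expf_eq0 (negPf (c0 _)) andbF orbF (negPf ki).
Qed.

End SingularPoints.

(** * Algebraic dependence *)

Lemma msizeM_leq n (R : idomainType) (p q : {mpoly R[n]}) :
  (msize (p * q) <= (msize p + msize q).-1)%N.
Proof.
have [->|p0] := eqVneq p 0; first by rewrite mul0r msize0.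
have [->|q0] := eqVneq q 0; first by rewrite mulr0 msize0.
by rewrite msizeM.
Qed.

Lemma linear_dependence (k : fieldType) (K : nzRingType) (f : {rmorphism k -> K})
    (I J : finType) (z : I -> K) (w : J -> K) (A : I -> J -> k) :
    (#|J| < #|I|)%N -> (forall i, z i = \sum_j f (A i j) * w j) ->
  exists2 c : I -> k, (exists i, c i != 0) & \sum_i f (c i) * z i = 0.
Proof.
move=> JI Ez; pose M : 'M[k]_(#|I|, #|J|) := \matrix_(i, j) A (enum_val i) (enum_val j).
have : kermx M != 0.
  rewrite -mxrank_eq0 mxrank_ker subn_eq0 -ltnNge.
  exact: leq_ltn_trans (rank_leq_col _) _.
case/rowV0Pn => v /sub_kermxP vM v0.
exists (fun i => v 0 (enum_rank i)).
  have /rV0Pn [i vi] := v0.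
  by exists (enum_val i); rewrite enum_valK.
under eq_bigr do rewrite Ez mulr_sumr.
rewrite exchange_big big1 // => j _.
under eq_bigr do rewrite mulrA -rmorphM.
rewrite -mulr_suml -rmorph_sum (_ : \sum_i _ = 0) ?rmorph0 ?mul0r //.
have /matrixP/(_ 0 (enum_rank j)) := vM; rewrite !mxE => E; rewrite -[RHS]E.
rewrite (reindex (@enum_val I I)) /=; last first.
  by exists enum_rank => i _; rewrite ?enum_valK ?enum_rankK.
by apply: eq_bigr => i _; rewrite enum_valK !mxE enum_rankK.
Qed.

(** The polynomial relation has coefficients in k[u]; it is its image in K[x]
    that must not vanish. *)
Definition algebraic_over (k K : comNzRingType) (f : {rmorphism k -> K}) t (u : 'I_t -> K) (x : K) :=
  exists p : {poly {mpoly k[t]}},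
    map_poly (mmap f u) p != 0 /\ root (map_poly (mmap f u) p) x.

(** A transcendence degree bound, proved by counting dimensions: if K contains x
    algebraic over t elements u, then more than t polynomials in x are
    algebraically dependent. *)
Section AlgebraicDependence.
Variables (k K : fieldType) (f : {rmorphism k -> K}) (t s : nat).
Variables (u : 'I_t -> K) (x : 'I_s -> K).
Hypothesis xalg : forall i, algebraic_over f u (x i).

Let ev : {rmorphism {mpoly k[t]} -> K} := mmap f u.

(** One denominator D and one exponent e + 1 serve for all the x i: multiply the
    relation of x i by the other leading coefficients and by a power of x i. *)
Let reduction : exists e (D : {mpoly k[t]}) (a : 'I_s -> 'I_e.+1 -> {mpoly k[t]}),
  ev D != 0 /\ forall i, ev D * x i ^+ e.+1 = \sum_j ev (a i j) * x i ^+ j.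
Proof.
have red1 i : exists eDa : nat * {mpoly k[t]} * (nat -> {mpoly k[t]}),
    ev eDa.1.2 != 0 /\ ev eDa.1.2 * x i ^+ eDa.1.1 =
       \sum_(j < eDa.1.1) ev (eDa.2 j) * x i ^+ j.
  have [p [p0 /rootP px]] := xalg i; rewrite -/ev in p0 px.
  set q := map_poly ev p in p0 px.
  exists ((size q).-1, p`_(size q).-1, fun j => - p`_j) => /=.
  have qE j : ev p`_j = q`_j by rewrite coef_map.
  split; first by rewrite qE -/(lead_coef q) lead_coef_eq0.
  move: px; rewrite horner_coef -(prednK (_ : 0 < size q)%N) ?size_poly_gt0 //.
  rewrite big_ord_recr /= -qE => /eqP; rewrite addrC addr_eq0 => /eqP ->.
  by rewrite -sumrN; apply: eq_bigr => j _; rewrite rmorphN qE mulNr.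
have [g Hg] := fin_all_exists red1.
pose E := (\max_i (g i).1.1)%N.
have Ei i : ((g i).1.1 <= E)%N by apply: (bigmax_sup i).
pose D := \prod_i (g i).1.2.
pose D' i := \prod_(j | j != i) (g j).1.2.
pose a i (j : 'I_E.+1) := if (E.+1 - (g i).1.1 <= j)%N then D' i * (g i).2 (j - (E.+1 - (g i).1.1))%N else 0.
exists E, D, a; split; first by rewrite rmorph_prod; apply/prodf_neq0 => i _; case: (Hg i).
move=> i; have [_ Hi] := Hg i.
have le : ((g i).1.1 <= E.+1)%N by rewrite (leq_trans (Ei i)).
rewrite /D (bigD1 i) //= -/(D' i) rmorphM mulrAC -{1}(subnKC le) exprD mulrA Hi.
pose F j := if (E.+1 - (g i).1.1 <= j)%N then ev ((g i).2 (j - (E.+1 - (g i).1.1))%N) * x i ^+ j else 0.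
transitivity (ev (D' i) * \sum_(j < E.+1) F j); last first.
  rewrite mulr_sumr; apply: eq_bigr => j _; rewrite /a /F; case: ifP => _.
    by rewrite rmorphM mulrA.
  by rewrite rmorph0 mulr0 mul0r.
rewrite mulrC; congr (_ * _).
have -> : \sum_(j < E.+1) F j = \sum_(0 <= j < E.+1) F j by rewrite big_mkord.
rewrite (@big_cat_nat _ _ _ (E.+1 - (g i).1.1)) ?leq_subr //=.
have -> : \sum_(0 <= j < E.+1 - (g i).1.1) F j = 0.
  by apply: big1_seq => j; rewrite mem_index_iota => /andP [_ /andP [_ jl]]; rewrite /F leqNgt jl.
rewrite add0r.
have -> : \sum_(E.+1 - (g i).1.1 <= j < E.+1) F j =
    \sum_(j < (g i).1.1) F (j + (E.+1 - (g i).1.1))%N.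
  by rewrite -{1}[(E.+1 - _)%N]add0n big_addn subKn // big_mkord.
rewrite mulr_suml.
by apply: eq_bigr => j _; rewrite /F leq_addl addnK -mulrA -exprD.
Qed.

Lemma card_bmultinom M : (#|{: 'X_{1..t < M.+1}}| <= M.+1 ^ t)%N.
Proof.
pose h (m : 'X_{1..t < M.+1}) : {ffun 'I_t -> 'I_M.+1} := [ffun i => inord (m i)].
have le (m : 'X_{1..t < M.+1}) i : (m i < M.+1)%N.
  apply: leq_ltn_trans (bmdeg m); rewrite mdegE (bigD1 i) //=; exact: leq_addr.
have hi : injective h.
  move=> m m' /ffunP E; apply/val_inj/mnmP => i; have := congr1 val (E i).
  by rewrite !ffunE /= !inordK.
by have := leq_card h hi; rewrite card_ffun !card_ord.
Qed.

(** Let V M be the set of combinations of the x ^ ga with all exponents at most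
    e, with coefficients of degree at most M in u. By the reduction,
    multiplication by D * x i maps V M into V (M + W). So the monomials of degree
    at most m in each y i, times a power of D, lie in some V (C * m); there are
    (m + 1) ^ l of these, against at most a constant times (m + 1) ^ t generators
    of V (C * m) over k. *)
Theorem algebraic_dependence l (y : 'I_l -> {mpoly k[s]}) : (t < l)%N ->
  exists2 g : {mpoly k[l]}, g != 0 & mmap f (fun i => mmap f x (y i)) g = 0.
Proof.
move=> tl; have [e [D [a [D0 Dx]]]] := reduction.
pose W := maxn (msize D) (\max_i \max_j msize (a i j)).
have DW : (msize D <= W.+1)%N by rewrite leqW // leq_maxl.
have aW i j : (msize (a i j) <= W.+1)%N.
  rewrite leqW // leq_max; apply/orP; right.
  by apply: (bigmax_sup i) => //; apply: (bigmax_sup j).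
pose xg (ga : {ffun 'I_s -> 'I_e.+1}) := \prod_i x i ^+ ga i.
pose V M z := exists2 b : {ffun 'I_s -> 'I_e.+1} -> {mpoly k[t]},
  forall ga, (msize (b ga) <= M.+1)%N & z = \sum_ga ev (b ga) * xg ga.
have V0 M : V M 0.
  exists (fun=> 0) => [ga|]; first by rewrite msize0.
  by rewrite big1 // => ga _; rewrite rmorph0 mul0r.
have VD M z z' : V M z -> V M z' -> V M (z + z').
  move=> [b bM ->] [b' b'M ->]; exists (fun ga => b ga + b' ga) => [ga|].
    by rewrite (leq_trans (msizeD_le _ _)) // geq_max bM b'M.
  by rewrite -big_split; apply: eq_bigr => ga _; rewrite rmorphD mulrDl.
have V1 M q ga : (msize q <= M.+1)%N -> V M (ev q * xg ga).
  move=> qM; exists (fun ga' => if ga' == ga then q else 0) => [ga'|].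
    by case: eqP => _; rewrite ?msize0.
  rewrite (bigD1 ga) //= eqxx big1 ?addr0 // => ga' /negPf ->.
  by rewrite rmorph0 mul0r.
have VS M (I : finType) (F : I -> K) : (forall i, V M (F i)) -> V M (\sum_i F i).
  by move=> FV; apply: big_ind; [exact: V0 | exact: VD | move=> i _; exact: FV].
have sM (q r : {mpoly k[t]}) M : (msize q <= M.+1)%N -> (msize r <= W.+1)%N ->
    (msize (r * q) <= (M + W).+1)%N.
  move=> qM rW; apply: leq_trans (msizeM_leq _ _) _.
  by move: qM rW; move: (msize q) (msize r) => m m'; clear; lia.
have VDM M z : V M z -> V (M + W)%N (ev D * z).
  move=> [b bM ->]; rewrite mulr_sumr; apply: (VS) => ga; rewrite mulrA -rmorphM.
  by apply: V1; exact: sM.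
have VX M z i : V M z -> V (M + W)%N (ev D * x i * z).
  move=> [b bM ->]; rewrite mulr_sumr; apply: (VS) => ga.
  pose upd (j : 'I_e.+1) : {ffun 'I_s -> 'I_e.+1} := [ffun i' => if i' == i then j else ga i'].
  have xupd j : xg (upd j) = x i ^+ j * \prod_(i' | i' != i) x i' ^+ ga i'.
    rewrite /xg (bigD1 i) //= ffunE eqxx; congr (_ * _).
    by apply: eq_bigr => i' i'i; rewrite ffunE (negPf i'i).
  have xgE : xg ga = x i ^+ ga i * \prod_(i' | i' != i) x i' ^+ ga i'.
    by rewrite /xg (bigD1 i).
  have [gi|gi] := ltnP (ga i).+1 e.+1.
    have -> : ev D * x i * (ev (b ga) * xg ga) = ev (D * b ga) * xg (upd (Ordinal gi)).
      by rewrite xupd xgE rmorphM /= exprS; ring.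
    by apply: V1; exact: sM.
  have -> : ev D * x i * (ev (b ga) * xg ga) =
      \sum_j ev (a i j * b ga) * xg (upd j).
    have Eg : ga i = e :> nat by apply/eqP; rewrite eqn_leq -ltnS ltn_ord.
    transitivity ((ev D * x i ^+ e.+1) * (ev (b ga) * \prod_(i' | i' != i) x i' ^+ ga i')).
      by rewrite xgE Eg exprS; ring.
    rewrite Dx mulr_suml; apply: eq_bigr => j _; rewrite xupd rmorphM; ring.
  by apply: (VS) => j; apply: V1; exact: sM.
have Vm m : V (m * W)%N (ev D ^+ m).
  elim: m => [|m IH]; last by rewrite mulSn addnC exprS; exact: VDM.
  have -> : ev D ^+ 0 = ev 1 * xg [ffun=> ord0].
    by rewrite rmorph1 mul1r /xg big1 // => i _; rewrite ffunE.
  by apply: V1; rewrite msize1.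
have Vmon m al : (mdeg al <= m)%N -> V (m * W)%N (ev D ^+ m * \prod_i x i ^+ al i).
  elim: m al => [|m IH] al.
    rewrite leqn0 mdeg_eq0 => /eqP ->; rewrite big1 ?mulr1 // => i _.
    by rewrite mnm0E.
  have [-> _|al0] := eqVneq al 0%MM.
    by rewrite big1 ?mulr1 // => i _; rewrite mnm0E.
  have /existsP [i ali] : [exists i, al i != 0%N].
    apply: contraNT al0; rewrite negb_exists => /forallP al0; apply/eqP/mnmP => i.
    by rewrite mnm0E; apply/eqP; have := al0 i; rewrite negbK.
  have Eal : al = (U_(i) + (al - U_(i)))%MM.
    by rewrite addmC submK // lep1mP.
  rewrite {1}Eal mdegD mdeg1 add1n ltnS => /IH VI.
  have -> : ev D ^+ m.+1 * \prod_i x i ^+ al i =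
     ev D * x i * (ev D ^+ m * \prod_i0 x i0 ^+ (al - U_(i))%MM i0).
    have -> : \prod_i x i ^+ al i = x i * \prod_i0 x i0 ^+ (al - U_(i))%MM i0.
      rewrite {1}Eal -[x i](mmap1U x) -/(mmap1 x _) -[X in _ = _ * X]/(mmap1 x _).
      rewrite commr_mmap1_M // => *; exact: mulrC.
    by rewrite exprS; ring.
  by rewrite mulSn addnC; exact: VX.
have Vpoly m (h : {mpoly k[s]}) : (msize h <= m.+1)%N -> V (m * W)%N (ev D ^+ m * mmap f x h).
  move=> hm; rewrite /mmap big_seq mulr_sumr; apply: big_ind; [exact: V0 | exact: VD |] => al alh.
  rewrite mulrCA.
  have -> : f h@_al = ev (h@_al)%:MP by rewrite /ev /= mmapC.
  have /Vmon [b bM ->] : (mdeg al <= m)%N.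
    by rewrite -ltnS (leq_trans (msize_mdeg_lt alh)).
  rewrite mulr_sumr; apply: (VS) => ga; rewrite mulrA -rmorphM; apply: V1.
  by rewrite mul_mpolyC (leq_trans (msizeZ_le _ _)).
pose Y := \max_i msize (y i).
have Yy i : (msize (y i) <= Y.+1)%N by rewrite leqW //; apply: (bigmax_sup i).
pose C := (Y * l * W)%N.
(* With this m there are at most m * (m + 1) ^ t generators of V (C * m), and
   this is less than (m + 1) ^ l. *)
pose m := (C.+1 ^ t * e.+1 ^ s)%N.
pose mon (al : {ffun 'I_l -> 'I_m.+1}) : 'X_{1..l} := [multinom val (al i) | i < l].
pose z al := ev D ^+ (Y * l * m) * \prod_i mmap f x (y i) ^+ mon al i.
have Vz al : V (C * m)%N (z al).
  have -> : (C * m = Y * l * m * W)%N by rewrite /C mulnAC.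
  have -> : z al = ev D ^+ (Y * l * m) * mmap f x (\prod_i y i ^+ mon al i).
    by rewrite /z rmorph_prod; congr (_ * _); apply: eq_bigr => i _; rewrite rmorphXn.
  apply: Vpoly.
  have szX (h : {mpoly k[s]}) r : (msize h <= Y.+1)%N -> (msize (h ^+ r) <= (Y * r).+1)%N.
    move=> hY; elim: r => [|r IH]; first by rewrite msize1.
    rewrite exprS mulnS; apply: leq_trans (msizeM_leq _ _) _.
    by move: hY IH; move: (msize _) (msize _) (Y * r)%N => a1 a2 a3; clear; lia.
  have : (msize (\prod_(i < l) y i ^+ mon al i) <= (\sum_(i < l) Y * m).+1)%N.
    elim/big_ind2: _ => [|r1 h1 r2 h2 H1 H2|i _]; first by rewrite msize1.
      apply: leq_trans (msizeM_leq _ _) _; move: H1 H2.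
      by move: (msize _) (msize _) => a1 a2; clear; lia.
    apply: leq_trans (szX _ _ (Yy i)) _; rewrite ltnS leq_mul2l; apply/orP; right.
    by rewrite mnmE -ltnS ltn_ord.
  by rewrite sum_nat_const card_ord mulnCA mulnA.
pose J := ('X_{1..t < (C * m).+1} * {ffun 'I_s -> 'I_e.+1})%type.
pose w (j : J) := (\prod_i u i ^+ (val j.1) i) * xg j.2.
have /fin_all_exists [A zA] : forall al, exists A : J -> k,
    z al = \sum_j f (A j) * w j.
  move=> al; have [b bM ->] := Vz al; exists (fun j => (b j.2)@_(val j.1)).
  rewrite -(pair_bigA _ (fun m ga => f (b ga)@_(val m) * w (m, ga))) exchange_big /=.
  apply: eq_bigr => ga _; rewrite /ev /= (mmapE _ (bM ga)) mulr_suml.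
  by apply: eq_bigr => be _; rewrite /w /= mulrA.
have cJI : (#|{: J}| < #|{: {ffun 'I_l -> 'I_m.+1}}|)%N.
  rewrite card_prod !card_ffun !card_ord.
  apply: (@leq_ltn_trans ((C.+1 * m.+1) ^ t * e.+1 ^ s)).
    rewrite leq_mul2r; apply/orP; right; apply: leq_trans (card_bmultinom _) _.
    case: (t) => // t'; rewrite leq_exp2r // mulSn mulnS addnA -addn1.
    by clear; lia.
  rewrite expnMn mulnAC -/m; apply: (@leq_trans (m.+1 ^ t.+1)).
    by rewrite expnS ltn_mul2r ltnSn expn_gt0.
  by rewrite leq_pexp2l.
have [c [al0 cal0] Ec] := linear_dependence cJI zA.
have mon_inj : injective mon.
  move=> al al' E; apply/ffunP => i; apply: val_inj.
  by have /mnmP/(_ i) := E; rewrite !mnmE.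
exists (\sum_al c al *: 'X_[mon al]).
  apply: contraNneq cal0 => /(congr1 (mcoeff (mon al0))); rewrite mcoeff0 raddf_sum.
  rewrite (bigD1 al0) //= mcoeffZ mcoeffX eqxx mulr1 big1 ?addr0 => [-> //|al ne].
  by rewrite mcoeffZ mcoeffX (inj_eq mon_inj) (negPf ne) mulr0.
have Dm0 : ev D ^+ (Y * l * m) != 0 by rewrite expf_neq0.
apply: (mulfI Dm0); rewrite mulr0 -[RHS]Ec raddf_sum mulr_sumr.
by apply: eq_bigr => al _ /=; rewrite mmapZ mmapX /z mulrCA.
Qed.

End AlgebraicDependence.

(** * Chains of primes in the scheme X *)

Lemma prime_idealP (R : comNzRingType) (P : {pred R}) :
  idealr_closed P -> prime_idealr_closed P ->
  [/\ 0 \in P, 1 \notin P, forall u v, u \in P -> v \in P -> u + v \in P,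
      forall u v, v \in P -> u * v \in P
    & forall u v, u * v \in P -> u \notin P -> v \in P].
Proof.
move=> [P0 P1 PD] Pp; split=> // [u v uP vP|u v vP|u v uvP uP].
- by rewrite -[u]mul1r; exact: PD.
- by rewrite -[u * v]addr0; exact: PD.
by have := Pp _ _ uvP; rewrite (negPf uP).
Qed.

(** For a decreasing chain P 0 > ... > P l with h i in P i but not in P i.+1,
    the h i are algebraically independent modulo P l. In a relation g, divide
    out the last variable as often as possible: h l.-1 is not in the prime P l,
    so the quotient is still a relation. Its constant term is then nonzero, but it
    is a relation modulo P l.-1 between the other h i. *)
Lemma chain_independent (k : fieldType) (R : comNzRingType) (C : {rmorphism k -> R}) l
    (P : nat -> {pred R}) (h : 'I_l -> R) :
    (forall i, (i <= l)%N -> idealr_closed (P i) /\ prime_idealr_closed (P i)) ->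
    (forall i, (i < l)%N -> {subset P i.+1 <= P i}) ->
    (forall i : 'I_l, h i \in P i /\ h i \notin P i.+1) ->
  forall g : {mpoly k[l]}, mmap C h g \in P l -> g = 0.
Proof.
elim: l h => [|l IH] h Pp Ps hP g.
  have [P00 P1 _ PM _] := prime_idealP (Pp 0%N isT).1 (Pp 0%N isT).2.
  rewrite (nvar0_mpolyC g) mmapC => cP; have [-> //|c0] := eqVneq (g@_0%MM) 0.
  by case/negP: P1; rewrite -(rmorph1 C) -(mulVf c0) rmorphM PM.
move=> gP; apply/eqP; apply: contraT => /muni_neq0 ug0.
pose h' i := h (widen_ord (leqnSn l) i); pose ev : {rmorphism _ -> R} := mmap C h'.
have [m [q]] := multiplicity_XsubC (muni g) 0.
rewrite ug0 /= subr0 => q0 Eq.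
have [P0' P1 PD PM PI] := prime_idealP (Pp l.+1 (leqnn _)).1 (Pp l.+1 (leqnn _)).2.
have [hl hl'] := hP ord_max.
have qP : (map_poly ev q).[h ord_max] \in P l.+1.
  move: gP; rewrite mmap_muni -/ev Eq rmorphM rmorphXn /= map_polyX hornerM hornerXn.
  rewrite mulrC; elim: m {Eq} => [|m IHm]; first by rewrite mul1r.
  by rewrite exprS -mulrA => /PI /(_ hl').
have [Q0 Q1 QD QM QI] := prime_idealP (Pp l (leqnSn _)).1 (Pp l (leqnSn _)).2.
suff q00 : q`_0 = 0 by move: q0; rewrite rootE horner_coef0 q00 eqxx.
apply: (IH h') => [i il|i il|i|].
- by apply: Pp; rewrite leqW.
- by apply: Ps; rewrite leqW.
- exact: hP (widen_ord (leqnSn l) i).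
have [r Er] : exists r, map_poly ev q = r * 'X + (ev q`_0)%:P.
  have /factor_theorem [r Er] : root (map_poly ev q - (ev q`_0)%:P) 0.
    by rewrite rootE hornerD hornerN hornerC horner_coef0 coef_map subrr.
  by exists r; rewrite -['X]subr0 -polyC0 -Er subrK.
have -> : mmap C h' q`_0 = (map_poly ev q).[h ord_max] + (- r.[h ord_max]) * h ord_max.
  by rewrite Er hornerD hornerM hornerX hornerC /=; ring.
by apply: QD; [exact: (Ps l) | exact: QM].
Qed.

Lemma max_minors0_kernel (K : fieldType) m n (M : 'M[K]_(m, n)) :
    (forall f : {ffun 'I_m -> 'I_n}, \det (colsub f M) = 0) ->
  exists2 w : 'rV[K]_m, w != 0 & w *m M = 0.
Proof.
move=> M0; have : ~~ row_free M.
  apply/negP => rM; have rM' : row_full M^T by rewrite /row_full mxrank_tr.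
  have := fullrowsub_unit rM'; rewrite unitmxE -det_tr.
  have -> : (rowsub (fullrankfun rM') M^T)^T = colsub (fullrankfun rM') M.
    by rewrite -trmx_mxsub trmxK.
  by rewrite M0 unitr0.
rewrite -kermx_eq0 => /rowV0Pn [w /sub_kermxP wM w0].
by exists w.
Qed.

Lemma kernel_max_minors0 (K : fieldType) m n (M : 'M[K]_(m, n)) (w : 'rV[K]_m) f :
  w != 0 -> w *m M = 0 -> \det (colsub f M : 'M_m) = 0.
Proof.
move=> w0 wM; apply/eqP; apply: contraT => Mf; have Mu : colsub f M \in unitmx.
  by rewrite unitmxE unitfE.
have wMf : w *m colsub f M = 0.
  apply/rowP => j; have /rowP/(_ (f j)) := wM; rewrite !mxE => E; rewrite -[RHS]E.
  by apply: eq_bigr => l _; rewrite mxE.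
by case/eqP: w0; rewrite -[w](mulmxK Mu) wMf mul0mx.
Qed.

Section ChainLength.
Variables (k : fieldType) (d n : nat) (c : 'I_n -> 'I_3) (a : 'I_(n * 2) -> k).

Lemma monomial_mx_chart (K : comNzRingType) (pi : {rmorphism {mpoly k[n * 2]} -> K}) :
  map_mx pi (monomial_mx d (chart_mx k c)) = monomial_mx d (map_mx pi (chart_mx k c)).
Proof.
apply/matrixP => al i; rewrite !mxE rmorph_prod; apply: eq_bigr => j _.
by rewrite !mxE rmorphXn.
Qed.

Definition mexp (al : 'I_('C(2 + d, d))) : 'X_{1..3} := nth 0%MM (monomials3 d) al.

Lemma mexp_inj : injective mexp.
Proof.
move=> al al' /eqP; rewrite nth_uniq ?uniq_monomials3 ?size_monomials3 //.
by move/eqP/val_inj.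
Qed.

Lemma mdeg_mexp al : mdeg (mexp al) = d.
Proof. by apply/eqP; rewrite -mem_monomials3 mem_nth // size_monomials3. Qed.

(** Setting one of the three variables to 1 does not identify two monomials of
    degree d. *)
Lemma mexp_lift_inj (j : 'I_3) al al' :
  mexp al (lift j 0) = mexp al' (lift j 0) ->
  mexp al (lift j 1) = mexp al' (lift j 1) -> al = al'.
Proof.
move=> E0 E1; apply: mexp_inj; apply/mnmP.
have deg x : (mexp x j + (mexp x (lift j 0%R) + mexp x (lift j 1%R)) = d)%N.
  rewrite -[RHS](mdeg_mexp x) mdegE (bigD1_ord j) //=; congr addn.
  rewrite !big_ord_recl big_ord0 addn0.
  by congr (mexp x (lift j _) + mexp x (lift j _))%N; apply: val_inj.
move=> i; case: (unliftP j i) => [l ->|->].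
  case: l => -[|[|//]] hl; first by rewrite (_ : Ordinal hl = 0) //; apply: val_inj.
  by rewrite (_ : Ordinal hl = 1) //; apply: val_inj.
by have := deg al; rewrite -(deg al') E0 E1 => /eqP; rewrite eqn_add2r => /eqP.
Qed.

Section AlgebraicCoordinates.
Variables (K : fieldType) (phi : {rmorphism k -> K}) (x : 'I_(n * 2) -> K).
Variable w : 'rV[K]_('C(2 + d, d)).
Let X : 'M[K]_(n, 3) :=
  \matrix_(i, j) if unlift (c i) j is Some j' then x (mxvec_index i j') else 1.
Hypotheses (w0 : w != 0) (wX : w *m monomial_mx d X = 0).

Let e0 i al := mexp al (lift (c i) 0).
Let e1 i al := mexp al (lift (c i) 1).
Let x0 i := x (mxvec_index i 0).
Let x1 i := x (mxvec_index i 1).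

(** The parameters u are the coefficients cw of the curve w other than the be-th,
    which is normalized to 1, and one affine coordinate of each point. The
    equation F i of the curve along the line through the i-th point on which x0
    is constant makes x1 i algebraic. If F i is identically 0, then this line is
    contained in the curve, and the coefficient of x1 ^ (e1 i be) in the equation
    is a polynomial in x0 i with a coefficient 1, so it is x0 i that is
    algebraic, and x1 i is taken as the parameter. *)
Lemma coords_algebraic :
  exists u : 'I_(n + ('C(2 + d, d)).-1) -> K, forall v, algebraic_over phi u (x v).
Proof.
have /rV0Pn [be wb] := w0.
pose cw al := w 0 al / w 0 be.
have cwb : cw be = 1 by rewrite /cw divff.
have wc al : w 0 be * cw al = w 0 al by rewrite mulrC divfK.
have rel i : \sum_al cw al * (x0 i ^+ e0 i al * x1 i ^+ e1 i al) = 0.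
  have /matrixP/(_ 0 i) := wX; rewrite !mxE => E.
  apply: (mulfI wb); rewrite mulr0 -[RHS]E mulr_sumr; apply: eq_bigr => al _.
  rewrite (mulrA (w 0 be) (cw al)) wc mxE; congr (_ * _).
  rewrite (bigD1_ord (c i)) //= mxE unlift_none expr1n mul1r.
  rewrite !big_ord_recl big_ord0 mulr1 !mxE !liftK.
  by rewrite /x0 /x1 /e0 /e1 /mexp (_ : lift ord0 ord0 = 1) //; apply: val_inj.
pose F i : {poly K} := \sum_al (cw al * x0 i ^+ e0 i al) *: 'X^(e1 i al).
pose s i := F i != 0.
pose u (v : 'I_(n + ('C(2 + d, d)).-1)) : K :=
  match split v with
  | inl i => if s i then x0 i else x1 i
  | inr q => cw (lift be q)
  end.
pose Xl i : {mpoly k[n + ('C(2 + d, d)).-1]} := 'X_(lshift _ i).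
pose ch al : {mpoly k[n + ('C(2 + d, d)).-1]} :=
  if unlift be al is Some q then 'X_(rshift n q) else 1.
have evX i : mmap phi u (Xl i) = if s i then x0 i else x1 i.
  by rewrite /Xl mmapX mmap1U /u (unsplitK (inl i)).
have evc al : mmap phi u (ch al) = cw al.
  rewrite /ch; case: unliftP => [q ->|->]; last by rewrite rmorph1.
  by rewrite mmapX mmap1U /u (unsplitK (inr q)).
have param i : algebraic_over phi u (if s i then x0 i else x1 i).
  exists ('X - (Xl i)%:P); rewrite rmorphB /= map_polyX map_polyC /= evX.
  by rewrite polyXsubC_eq0 root_XsubC.
exists u => v; case/mxvec_indexP: v => i j; have := param i.
have [Fi|Fi] := boolP (s i) => pi.
  case: j => -[|[|//]] hj.
    by rewrite (_ : Ordinal hj = 0) //; apply: val_inj.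
  rewrite (_ : Ordinal hj = 1) -?/(x1 i); last exact: val_inj.
  exists (\sum_al (ch al * Xl i ^+ e0 i al) *: 'X^(e1 i al)).
  have -> : map_poly (mmap phi u) (\sum_al (ch al * Xl i ^+ e0 i al) *: 'X^(e1 i al)) = F i.
    rewrite rmorph_sum; apply: eq_bigr => al _.
    by rewrite /= map_polyZ map_polyXn rmorphM rmorphXn /= evc evX Fi.
  split=> //; rewrite rootE /F horner_sum -[X in _ == X](rel i); apply/eqP.
  by apply: eq_bigr => al _; rewrite hornerZ hornerXn mulrA.
case: j => -[|[|//]] hj; last first.
  by rewrite (_ : Ordinal hj = 1) //; apply: val_inj.
rewrite (_ : Ordinal hj = 0) -?/(x0 i); last exact: val_inj.
exists (\sum_(al | e1 i al == e1 i be) ch al *: 'X^(e0 i al)).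
have -> : map_poly (mmap phi u) (\sum_(al | e1 i al == e1 i be) ch al *: 'X^(e0 i al))
   = \sum_(al | e1 i al == e1 i be) cw al *: 'X^(e0 i al).
  rewrite rmorph_sum; apply: eq_bigr => al _.
  by rewrite [LHS]map_polyZ map_polyXn; congr (_ *: _); exact: evc.
split.
  apply/eqP => /(congr1 (fun q : {poly K} => q`_(e0 i be))) /eqP.
  rewrite coef0 coef_sum (bigD1 be) //= coefZ coefXn eqxx mulr1 cwb big1.
    by rewrite addr0 oner_eq0.
  move=> al /andP [/eqP al1 albe]; rewrite coefZ coefXn.
  case: eqP => [al0|_]; last by rewrite mulr0.
  by case/eqP: albe; apply: mexp_lift_inj al1.
have /eqP F0 : F i == 0 by rewrite -[_ == _]negbK.
rewrite rootE horner_sum -[X in _ == X](coef0 _ (e1 i be)) -F0 /F coef_sum big_mkcond.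
apply/eqP; apply: eq_bigr => al _; rewrite coefZ coefXn hornerZ hornerXn eq_sym.
by case: eqP; rewrite ?mulr1 ?mulr0.
Qed.

End AlgebraicCoordinates.

(** Over the residue field K of the first prime of the chain all minors vanish,
    so that the generic points lie on a curve w, and coords_algebraic bounds the
    number of independent elements supplied by the chain. *)
Theorem X_chain_length l P : prime_chain (@X_chart_eqs k d n c) a l P ->
  (l <= n + ('C(2 + d, d)).-1)%N.
Proof.
move=> [Pp Ps PX Pa]; rewrite leqNgt; apply/negP => ln.
have [K [pi piP]] := prime_field (Pp 0%N isT).1 (Pp 0%N isT).2.
pose phi : {rmorphism k -> K} := pi \o @mpolyC (n * 2) k.
pose x i := pi 'X_i.
have piE h : mmap phi x h = pi h.
  elim/mpoly_ring_ind: h => [e|i|g h Eg Eh|g h Eg Eh].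
  - by rewrite mmapC.
  - by rewrite mmapX mmap1U.
  - by rewrite mmapD rmorphD Eg Eh.
  - by rewrite mmapM rmorphM Eg Eh.
have /fin_all_exists [h hP] : forall i : 'I_l, exists h,
    h \in P (l - i)%N /\ h \notin P (l - i.+1)%N.
  move=> i; have [|_ [h h1 h2]] := Ps (l - i.+1)%N.
    by rewrite -subSn ?leq_subr // subSS leq_subr.
  by exists h; move: h1; rewrite -subSn // subSS.
have indep := @chain_independent k _ (@mpolyC (n * 2) k) l (fun i => P (l - i)%N) h.
have [u xu] : exists u : 'I_(n + ('C(2 + d, d)).-1) -> K, forall i, algebraic_over phi u (x i).
  have [w w0 wM] : exists2 w : 'rV[K]_('C(2 + d, d)), w != 0 &
      w *m monomial_mx d (map_mx pi (chart_mx k c)) = 0.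
    apply: max_minors0_kernel => f; rewrite -monomial_mx_chart -map_mxsub det_map_mx.
    by apply/eqP; rewrite piP; exact: PX.
  apply: (@coords_algebraic K phi x w w0); rewrite -[RHS]wM; congr (_ *m monomial_mx d _).
  apply/matrixP => i j; rewrite !mxE /x; case: unlift => // ; by rewrite rmorph1.
have [g g0 Eg] := algebraic_dependence xu h ln.
case/eqP: g0; apply: indep.
- by move=> i _; apply: Pp; exact: leq_subr.
- move=> i il; have [|s _] := Ps (l - i.+1)%N.
    by rewrite -subSn ?leq_subr // subSS leq_subr.
  by move=> y /s; rewrite -subSn // subSS.
- exact: hP.
rewrite subnn -piP -[X in X == _]/(pi _); apply/eqP; rewrite -[RHS]Eg.
elim/mpoly_ring_ind: (g) => [e|i|g1 g2 E1 E2|g1 g2 E1 E2].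
- by rewrite !mmapC.
- by rewrite !mmapX !mmap1U piE.
- by rewrite !mmapD rmorphD E1 E2.
- by rewrite !mmapM rmorphM E1 E2.
Qed.

End ChainLength.

(** * Chains of primes from independent differentials *)

(** The c h i are the coefficients of a power series attached to h; so c is a
    ring morphism from R to the domain of power series over S, and its kernel is
    prime. *)
Lemma series_kernel_prime (R : comNzRingType) (S : idomainType) (c : R -> nat -> S) :
    (forall f g i, c (f + g) i = c f i + c g i) ->
    (forall f g i, c (f * g) i = \sum_(j < i.+1) c f j * c g (i - j)%N) ->
    c 1 0%N != 0 ->
  let P := [pred h | asb (forall i, c h i = 0)] in
  idealr_closed P /\ prime_idealr_closed P.
Proof.
move=> cD cM c1 P.
have PP h : reflect (forall i, c h i = 0) (h \in P) by rewrite inE; exact: asbP.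
have c0 i : c 0 i = 0.
  by apply: (addrI (c 0 i)); rewrite -cD !addr0.
split; first split.
- exact/PP.
- by apply: contraNN c1 => /PP ->.
- move=> f g h /PP g0 /PP h0; apply/PP => i; rewrite cD cM h0 addr0 big1 // => j _.
  by rewrite g0 mulr0.
move=> g h /PP gh0; apply/orP; have [gP|gP] := boolP (g \in P); [by left|right].
have [hP|hP] := boolP (h \in P) => //.
have low f : f \notin P -> exists2 i, c f i != 0 & forall j, (j < i)%N -> c f j = 0.
  move=> fP; have : exists i, c f i != 0.
    apply: NNPP => nf; case/PP: fP => i; apply/eqP; apply: contraT => fi.
    by case: nf; exists i.
  case/ex_minnP => i fi imin; exists i => // j ji; apply/eqP; apply: contraT => /imin.
  by rewrite leqNgt ji.
have [i gi ig] := low _ gP; have [j hj jh] := low _ hP.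
have := gh0 (i + j)%N; have li : (i < (i + j).+1)%N by rewrite ltnS leq_addr.
rewrite cM (bigD1 (Ordinal li)) //= addKn big1 ?addr0 => [/eqP|l].
  by rewrite mulf_eq0 (negPf gi) (negPf hj).
rewrite -val_eqE /= neq_ltn => /orP [/ig ->|il]; first by rewrite mul0r.
by rewrite jh ?mulr0 // ltn_subLR 1?addnC ?ltn_add2r // -ltnS.
Qed.

Definition dvdX (A : nzRingType) m (f : {poly A}) := exists u, f = 'X^m * u.

Section DvdX.
Variable A : comNzRingType.
Implicit Types f g : {poly A}.

Lemma dvdX0 m : dvdX m (0 : {poly A}).
Proof. by exists 0; rewrite mulr0. Qed.

Lemma dvdXD m f g : dvdX m f -> dvdX m g -> dvdX m (f + g).
Proof. by move=> [u ->] [v ->]; exists (u + v); rewrite mulrDr. Qed.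

Lemma dvdXMl m f g : dvdX m g -> dvdX m (f * g).
Proof. by move=> [u ->]; exists (f * u); rewrite mulrCA. Qed.

Lemma dvdXMr m f g : dvdX m f -> dvdX m (f * g).
Proof. by rewrite mulrC; exact: dvdXMl. Qed.

Lemma dvdXM m n f g : dvdX m f -> dvdX n g -> dvdX (m + n) (f * g).
Proof. by move=> [u ->] [v ->]; exists (u * v); rewrite exprD; ring. Qed.

Lemma dvdXN m f : dvdX m f -> dvdX m (- f).
Proof. by move=> [u ->]; exists (- u); rewrite mulrN. Qed.

Lemma dvdX_sum m (I : Type) (r : seq I) (P : pred I) F :
  (forall i, P i -> dvdX m (F i : {poly A})) -> dvdX m (\sum_(i <- r | P i) F i).
Proof. by move=> Fm; apply: big_ind => //; [exact: dvdX0 | exact: dvdXD]. Qed.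

Lemma dvdX_leq m n f : (n <= m)%N -> dvdX m f -> dvdX n f.
Proof.
by move=> nm [u ->]; exists ('X^(m - n) * u); rewrite mulrA -exprD subnKC.
Qed.

Lemma dvdX_coef m f i : dvdX m f -> (i < m)%N -> f`_i = 0.
Proof. by move=> [u ->] im; rewrite coefXnM im. Qed.

Lemma dvdX_mmap s (k : comNzRingType) m (f : {rmorphism k -> {poly A}})
    (x y : 'I_s -> {poly A}) (h : {mpoly k[s]}) :
  (forall j, dvdX m (x j - y j)) -> dvdX m (mmap f x h - mmap f y h).
Proof.
move=> xy; elim/mpoly_ring_ind: h => [c|i|g h Eg Eh|g h Eg Eh].
- by rewrite !mmapC subrr; exact: dvdX0.
- by rewrite !mmapX !mmap1U.
- rewrite !mmapD; have -> : forall a b c d : {poly A}, a + b - (c + d) = (a - c) + (b - d).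
    by move=> *; ring.
  exact: dvdXD.
rewrite !rmorphM /=.
have -> : forall a b c d : {poly A}, a * b - c * d = a * (b - d) + (a - c) * d.
  by move=> *; ring.
by apply: dvdXD; [exact: dvdXMl | exact: dvdXMr].
Qed.

End DvdX.

Definition kill_vars l (k : comNzRingType) (j : nat) : {mpoly k[l]} -> {mpoly k[l]} :=
  mmap (@mpolyC l k) (fun i : 'I_l => if (i < j)%N then 0 else 'X_i).

HB.instance Definition _ l (k : comNzRingType) j :=
  GRing.RMorphism.on (@kill_vars l k j).

Lemma kill_varsX l (k : comNzRingType) j i :
  @kill_vars l k j 'X_i = if (i < j)%N then 0 else 'X_i.
Proof. by rewrite /kill_vars mmapX mmap1U. Qed.

Lemma kill_varsD l (k : comNzRingType) j : {morph @kill_vars l k j : f g / f + g}.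
Proof. exact: mmapD. Qed.

Lemma kill_varsM l (k : comNzRingType) j : {morph @kill_vars l k j : f g / f * g}.
Proof. exact: rmorphM. Qed.

Lemma kill_vars_kill l (k : comNzRingType) j (f : {mpoly k[l]}) :
  kill_vars j.+1 (kill_vars j f) = kill_vars j.+1 f.
Proof.
elim/mpoly_ring_ind: f => [e|i|g h Eg Eh|g h Eg Eh].
- by rewrite /kill_vars !mmapC.
- rewrite (@kill_varsX _ _ j); case: ifP => ij; last by [].
  by rewrite rmorph0 kill_varsX ltnS (ltnW ij).
- by rewrite !kill_varsD Eg Eh.
- by rewrite !kill_varsM Eg Eh.
Qed.

(** The T i have independent differentials at the zero a. Newton iteration
    produces a morphism from k[x] to power series in one variable t, over the
    polynomials in Y_1, ..., Y_l, which reduces to the evaluation at a modulo t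
    and maps T i to Y_i * t. The primes are the kernels of this morphism followed
    by Y_i := 0 for i < j. Power series are represented by their truncations:
    newton m is correct modulo t ^ (m + 1). *)
Section RegularChain.
Variables (k : fieldType) (s l : nat) (T : 'I_l -> {mpoly k[s]}) (a : 'I_s -> k).
Hypothesis Ta : forall i, (T i).@[a] = 0.
Let J : 'M[k]_(l, s) := \matrix_(i, j) (T i)^`M(j).@[a].
Hypothesis Jfree : row_free J.

Let A : idomainType := {mpoly k[l]}.
Let B := {poly A}.
(** A right inverse of J is enough for Newton's method: there are more unknowns
    than equations. *)
Let Jr : 'M[k]_(s, l) := pinvmx J.

Let JK i i' : \sum_j J i j * Jr j i' = (i == i')%:R.
Proof.
have /matrixP/(_ i i') : J *m Jr = 1%:M.
  exact: mulmxVp.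
by rewrite !mxE.
Qed.

Let iota : {rmorphism k -> B} := polyC \o @mpolyC l k.
Let Jr_solves i (e : 'I_l -> B) :
  \sum_j iota (J i j) * (- \sum_i' iota (Jr j i') * e i') = - e i.
Proof.
transitivity (- \sum_i' \sum_j iota (J i j * Jr j i') * e i').
  rewrite exchange_big -sumrN; apply: eq_bigr => j _.
  rewrite mulrN mulr_sumr; congr (- _).
  by apply: eq_bigr => i' _; rewrite rmorphM mulrA.
have Ei i' : \sum_j iota (J i j * Jr j i') * e i' = (i == i')%:R * e i'.
  by rewrite -mulr_suml -[\sum_j _](rmorph_sum iota) JK rmorph_nat.
congr (- _); rewrite (bigD1 i) // Ei eqxx mul1r big1 => [|i' i'i]; first exact: addr0.
by rewrite Ei eq_sym (negPf i'i) mul0r.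
Qed.

Let y (i : 'I_l) : B := ('X_i)%:P * 'X.

Let err (x : 'I_s -> B) i := mmap iota x (T i) - y i.

Fixpoint newton m : 'I_s -> B :=
  if m is m'.+1 then
    fun j => newton m' j - \sum_i iota (Jr j i) * err (newton m') i
  else fun j => iota (a j).

Let psi m (h : {mpoly k[s]}) : B := mmap iota (newton m) h.

Let psi0 h : psi 0 h = iota h.@[a].
Proof.
rewrite /psi; elim/mpoly_ring_ind: h => [c|i|g h Eg Eh|g h Eg Eh].
- by rewrite mmapC mevalC.
- by rewrite mmapX mmap1U mevalXU.
- by rewrite mmapD mevalD Eg Eh rmorphD.
- by rewrite mevalM [RHS]rmorphM -Eg -Eh; exact: rmorphM.
Qed.

Let newton_inv m :
  (forall j, dvdX 1 (newton m j - iota (a j))) /\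
  (forall i, dvdX m.+1 (err (newton m) i)).
Proof.
elim: m => [|m [IH1 IH2]].
  split=> [j|i]; first by rewrite subrr; exact: dvdX0.
  rewrite /err -/(psi 0 _) psi0 Ta rmorph0 sub0r /y.
  by apply: dvdXN; exists ('X_i)%:P; rewrite expr1 mulrC.
pose del j := - \sum_i iota (Jr j i) * err (newton m) i.
have delm j : dvdX m.+1 (del j).
  by apply/dvdXN/dvdX_sum => i _; exact: dvdXMl.
split=> [j|i].
  rewrite /= -/(del j) addrAC; apply: dvdXD => //.
  by apply: dvdX_leq (delm j).
have [q [r Eq] Et] := mmap_taylor iota (newton m) del (T i).
rewrite /err -[mmap _ _ _]/(mmap iota (fun j => newton m j + del j) (T i)) Et.
have Ed h : dvdX 1 (mmap iota (newton m) h - iota h.@[a]).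
  by rewrite -psi0; exact: dvdX_mmap.
have -> : mmap iota (newton m) (T i) + \sum_j mmap iota (newton m) (T i)^`M(j) * del j + q - y i
  = (err (newton m) i + \sum_j iota (J i j) * del j)
    + (\sum_j (mmap iota (newton m) (T i)^`M(j) - iota (J i j)) * del j) + q.
  have -> : \sum_j (mmap iota (newton m) (T i)^`M(j) - iota (J i j)) * del j =
     \sum_j mmap iota (newton m) (T i)^`M(j) * del j - \sum_j iota (J i j) * del j.
    by rewrite -sumrB; apply: eq_bigr => j _; rewrite mulrBl.
  by rewrite /err; ring.
rewrite [\sum_j iota _ * _]Jr_solves.
rewrite subrr add0r; apply: dvdXD.
  apply: dvdX_sum => j _; rewrite -[m.+2]add1n; apply: dvdXM; last exact: delm.
  by rewrite /J mxE; exact: Ed.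
rewrite Eq; apply: dvdX_sum => j _; apply: dvdX_sum => j' _; apply: dvdXMl.
by apply: (@dvdX_leq _ (m.+1 + m.+1)); [rewrite addSn addnS ltnS ltnS leq_addr | exact: dvdXM].
Qed.

Let psiS m h : dvdX m.+1 (psi m.+1 h - psi m h).
Proof.
apply: dvdX_mmap => j; rewrite /= addrC addrA addNr add0r.
by apply/dvdXN/dvdX_sum => i _; apply: dvdXMl; exact: (newton_inv m).2.
Qed.

Let c h i : A := (psi i h)`_i.

Let psi_coef m h i : (i <= m)%N -> (psi m h)`_i = c h i.
Proof.
elim: m => [|m IH]; first by rewrite leqn0 => /eqP ->.
rewrite leq_eqVlt => /orP [/eqP -> //|im]; rewrite -IH //.
by apply/eqP; rewrite -subr_eq0 -coefB (dvdX_coef (psiS m h)).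
Qed.

Let cD f g i : c (f + g) i = c f i + c g i.
Proof. by rewrite /c /psi mmapD coefD. Qed.

Let cM f g i : c (f * g) i = \sum_(j < i.+1) c f j * c g (i - j)%N.
Proof.
rewrite {1}/c /psi rmorphM coefM; apply: eq_bigr => j _.
have fj : (psi i f)`_j = c f j by apply: psi_coef; rewrite -ltnS.
have gj : (psi i g)`_(i - j) = c g (i - j)%N by apply: psi_coef; exact: leq_subr.
by rewrite -fj -gj.
Qed.

Let c0 h : c h 0%N = (h.@[a])%:MP.
Proof. by rewrite /c psi0 /= coefC. Qed.

Let cT i m : c (T i) m = if m == 1%N then 'X_i else 0.
Proof.
have := dvdX_coef ((newton_inv m).2 i) (ltnSn m).
rewrite /err -/(psi m _) coefB => /eqP; rewrite subr_eq0 => /eqP.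
by rewrite /c => ->; rewrite /y mulrC coefXM coefC; case: m => [|[|m]].
Qed.

Let sp (j : nat) : {rmorphism A -> A} := @kill_vars l k j.

Let spX j (i : 'I_l) : sp j 'X_i = if (i < j)%N then 0 else 'X_i.
Proof. exact: kill_varsX. Qed.

Let sp_sp j f : sp j.+1 (sp j f) = sp j.+1 f.
Proof. exact: kill_vars_kill. Qed.

(** T i maps to Y_i * t, and therefore it is in the j-th kernel exactly when Y_i
    has been set to 0; this makes the inclusions strict. *)
Theorem regular_chain : exists Q : nat -> {pred {mpoly k[s]}},
  [/\ forall j, idealr_closed (Q j) /\ prime_idealr_closed (Q j),
      forall j, {subset Q j <= Q j.+1},
      forall j (i : 'I_l), (T i \in Q j) = (i < j)%N
    & forall j h, h \in Q j -> h.@[a] = 0].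
Proof.
pose cs j h i := sp j (c h i).
pose Q j : {pred {mpoly k[s]}} := [pred h | asb (forall i, cs j h i = 0)].
have QP j h : reflect (forall i, cs j h i = 0) (h \in Q j) by rewrite inE; exact: asbP.
exists Q; split.
- move=> j; apply: series_kernel_prime => [f g i|f g i|].
  + by rewrite /cs cD rmorphD.
  + by rewrite /cs cM rmorph_sum; apply: eq_bigr => i' _; rewrite rmorphM.
  + by rewrite /cs c0 meval1 rmorph1 oner_neq0.
- move=> j h /QP h0; apply/QP => i.
  rewrite /cs; apply: etrans (esym (sp_sp j _)) _.
  exact: etrans (congr1 (sp j.+1) (h0 i)) (rmorph0 _).
- move=> j i; apply/QP/idP => [/(_ 1%N)|ij m]; rewrite /cs cT.
    rewrite eqxx spX; case: ifP => // _ X0.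
    by have := msizeX k U_(i)%MM; rewrite X0 msize0.
  by case: eqP => _; rewrite ?rmorph0 // spX ij.
move=> j h /QP/(_ 0%N); rewrite /cs c0 /sp /= /kill_vars mmapC => /eqP.
by rewrite mpolyC_eq0 => /eqP.
Qed.

End RegularChain.

(** * Differentials of the maximal minors *)

Lemma euler_homog n (R : comNzRingType) d (f : {mpoly R[n]}) :
  f \is d.-homog -> \sum_j 'X_j * f^`M(j) = f *+ d.
Proof.
move=> /dhomogP fd; rewrite [in RHS](mpolyE f) -sumrMnl [RHS]big_seq.
have -> : \sum_j 'X_j * f^`M(j) = \sum_j \sum_(m <- msupp f) f@_m *: ('X_j * 'X_[m]^`M(j)).
  apply: eq_bigr => j _; rewrite {1}(mpolyE f) raddf_sum mulr_sumr.
  by apply: eq_bigr => m _ /=; rewrite mderivZ scalerAr.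
rewrite exchange_big big_seq; apply: eq_bigr => m /fd md.
rewrite -scaler_sumr scalerMnr; congr (_ *: _).
have {md} -> : d = (\sum_j m j)%N by rewrite -mdegE -md.
rewrite -sumrMnr; apply: eq_bigr => j _; rewrite mderivX.
case: (posnP (m j)) => [->|mj]; first by rewrite scale0r mulr0 mulr0n.
rewrite -scalerAr -mpolyXD addmC submK; first by rewrite scaler_nat.
by rewrite lep1mP -lt0n.
Qed.

Lemma mderiv_mmap m n (R : comNzRingType) (x : 'I_m -> {mpoly R[n]}) (f : {mpoly R[m]}) v :
  (mmap (@mpolyC n R) x f)^`M(v) =
    \sum_j mmap (@mpolyC n R) x f^`M(j) * (x j)^`M(v).
Proof.
elim/mpoly_ring_ind: f => [e|i|g h Eg Eh|g h Eg Eh].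
- by rewrite mmapC mderivC big1 // => j _; rewrite mderivC mmap0 mul0r.
- rewrite mmapX mmap1U (bigD1 i) //= big1 => [|j ji].
    rewrite mderivX mnm1E eqxx scale1r addr0 (_ : (U_(i) - U_(i))%MM = 0%MM).
      by rewrite mmapX mmap11 mul1r.
    by apply/mnmP => j; rewrite mnmBE subnn mnm0E.
  by rewrite mderivX mnm1E eq_sym (negPf ji) scale0r mmap0 mul0r.
- rewrite mmapD mderivD Eg Eh -big_split; apply: eq_bigr => j _ /=.
  by rewrite mderivD mmapD mulrDl.
rewrite mmapM mderivM Eg Eh mulr_suml mulr_sumr -big_split; apply: eq_bigr => j _ /=.
rewrite mderivM mmapD !mmapM mulrDl; congr (_ + _); first exact: mulrAC.
by rewrite mulrA.
Qed.

Lemma meval_mderivM n (R : comNzRingType) (f g : {mpoly R[n]}) a v :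
  ((f * g)^`M(v)).@[a] = (f^`M(v)).@[a] * g.@[a] + f.@[a] * (g^`M(v)).@[a].
Proof. by rewrite mderivM mevalD !mevalM. Qed.

(** A maximal minor, seen as a function of its column b0, is the linear form on
    columns whose coefficients are a row of the adjugate. *)
Section ColumnReplacement.
Variables (R : comNzRingType) (m n : nat) (A : 'M[R]_(m, n)).
Variables (f : {ffun 'I_m -> 'I_n}) (b0 : 'I_m).

Definition set_col (i : 'I_n) : {ffun 'I_m -> 'I_n} :=
  [ffun b => if b == b0 then i else f b].

Lemma adj_set_col i al :
  \adj (colsub (set_col i) A) b0 al = \adj (colsub f A) b0 al.
Proof.
rewrite !mxE /cofactor; congr (_ * \det _); apply/matrixP => x y.
by rewrite !mxE ffunE eq_sym (negPf (neq_lift _ _)).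
Qed.

Lemma det_set_col i :
  \sum_al \adj (colsub f A) b0 al * A al i = \det (colsub (set_col i) A).
Proof.
have /matrixP/(_ b0 b0) := mul_adj_mx (colsub (set_col i) A).
rewrite [RHS]mxE eqxx mulr1n => <-; rewrite [RHS]mxE; apply: eq_bigr => al _.
rewrite adj_set_col; congr (_ * _).
by rewrite mxE ffunE eqxx.
Qed.

Lemma det_set_col0 b : b != b0 -> \det (colsub (set_col (f b)) A) = 0.
Proof.
move=> bb0; rewrite -det_set_col.
have /matrixP/(_ b0 b) := mul_adj_mx (colsub f A).
rewrite [RHS]mxE eq_sym (negPf bb0) mulr0n => E; rewrite -[RHS]E [RHS]mxE.
by apply: eq_bigr => al _; congr (_ * _); rewrite mxE.
Qed.

End ColumnReplacement.

(** M has m - 1 independent columns; they are put at the positions other than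
    b0. The column i0 at b0 is a placeholder, which the cofactors of that position
    do not see. *)
Lemma exists_cofactor (k : fieldType) m n (M : 'M[k]_(m, n)) (i0 : 'I_n) :
    (\rank M).+1 = m ->
  exists (f : {ffun 'I_m -> 'I_n}) (b0 : 'I_m),
    {in [set~ b0] &, injective f} /\ exists al, \adj (colsub f M) b0 al != 0.
Proof.
case: m M => // m M [rM].
have rMT : \rank M^T = m by rewrite mxrank_tr.
pose h (b : 'I_m) := maxrankfun M^T (cast_ord (esym rMT) b).
have h_inj : injective h.
  by move=> b b' /maxrankfun_inj /cast_ord_inj.
pose Rm := rowsub h M^T.
have rRm : \rank Rm = m.
  have := @maxrowsub_free _ _ _ M^T; rewrite /row_free => /eqP rk.
  have -> : Rm = rowsub (cast_ord (esym rMT)) (rowsub (maxrankfun M^T) M^T).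
    by rewrite -mxsub_comp.
  by rewrite rowsub_cast eqmx_cast rk.
have [z zRm] : exists z : 'rV[k]_m.+1, ~~ (z <= Rm)%MS.
  have /row_subPn [i iR] : ~~ (1%:M <= Rm)%MS.
    by apply/negP => /mxrankS; rewrite mxrank1 rRm ltnn.
  by exists (row i 1%:M).
pose f : {ffun 'I_m.+1 -> 'I_n} :=
  [ffun b => if unlift ord0 b is Some b' then h b' else i0].
exists f, ord0; split.
  move=> b b'; rewrite !inE; case: (unliftP ord0 b) => [c ->|->]; last by rewrite eqxx.
  case: (unliftP ord0 b') => [c' ->|->]; last by rewrite eqxx.
  by rewrite !ffunE !liftK => _ _ /h_inj ->.
pose S : 'M[k]_m.+1 := (col_mx z Rm : 'M_(1 + m, m.+1)).
have Su : S \in unitmx.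
  rewrite -row_full_unit /row_full eqn_leq rank_leq_col /=.
  have -> : \rank S = \rank (z + Rm)%MS by rewrite addsmxE.
  rewrite -{1}rRm; suff : (Rm < z + Rm)%MS by rewrite ltmxErank => /andP [].
  rewrite ltmxE addsmxSr /=; apply: contra zRm; apply: submx_trans.
  exact: addsmxSl.
have : \det S != 0 by rewrite -unitfE -unitmxE.
rewrite (expand_det_row _ ord0) => S0.
have /existsP [al cal] : [exists al, cofactor S ord0 al != 0].
  apply: contraNT S0; rewrite negb_exists => /forallP c0; apply/eqP.
  by apply: big1 => al _; have := c0 al; rewrite negbK => /eqP ->; rewrite mulr0.
exists al; rewrite mxE -cofactor_tr; apply: contraNneq cal => <-.
rewrite /cofactor; apply/eqP; congr (_ * \det _); apply/matrixP => x y.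
rewrite 2![LHS]mxE 4![RHS]mxE ffunE liftK.
have -> : lift ord0 x = rshift 1 x by apply: val_inj.
transitivity (Rm x (lift al y)); first exact: col_mxEd.
by rewrite !mxE.
Qed.

(** Forms of degree d correspond to row vectors of coefficients, numbered like
    the rows of monomial_mx. *)
Section Forms.
Variables (k : fieldType) (d : nat).
Let N := 'C(2 + d, d).

Definition form_of (w : 'rV[k]_N) : {mpoly k[3]} :=
  \sum_al w 0 al *: 'X_[mexp al].

Definition coefs_of (f : {mpoly k[3]}) : 'rV[k]_N := \row_al f@_(mexp al).

Lemma form_of_homog w : form_of w \is d.-homog.
Proof.
apply: rpred_sum => al _; apply: dhomogZ; rewrite dhomogX; apply/eqP.
exact: mdeg_mexp.
Qed.

Lemma form_ofK w : coefs_of (form_of w) = w.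
Proof.
apply/rowP => al; rewrite mxE /form_of raddf_sum (bigD1 al) //= mcoeffZ mcoeffX eqxx.
rewrite mulr1 big1 ?addr0 // => be ne.
by rewrite mcoeffZ mcoeffX (inj_eq (@mexp_inj d)) (negPf ne) mulr0.
Qed.

Lemma coefs_ofK f : f \is d.-homog -> form_of (coefs_of f) = f.
Proof.
move=> /dhomogP fd; apply/mpolyP => m; rewrite raddf_sum.
have [md|md] := eqVneq (mdeg m) d; last first.
  rewrite (_ : f@_m = 0); last first.
    by apply: memN_msupp_eq0; apply: contraNN md => /fd md; apply/eqP.
  rewrite big1 // => al _ /=; rewrite mcoeffZ mcoeffX; case: eqP => [E|_]; last by rewrite mulr0.
  by case/eqP: md; rewrite -E mdeg_mexp.
have mm : m \in monomials3 d by rewrite mem_monomials3 md.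
have mi : (index m (monomials3 d) < N)%N by rewrite /N -size_monomials3 index_mem.
have Em : mexp (Ordinal mi) = m by rewrite /mexp nth_index.
rewrite (bigD1 (Ordinal mi)) //= mcoeffZ mcoeffX Em eqxx mulr1 big1 ?addr0.
  by rewrite mxE Em.
by move=> be ne; rewrite mcoeffZ mcoeffX -Em (inj_eq (@mexp_inj d)) (negPf ne) mulr0.
Qed.

Lemma eval_form_of n (x : 'M[k]_(n, 3)) w i :
  (form_of w).@[x i] = (w *m monomial_mx d x) 0 i.
Proof.
rewrite mxE /form_of raddf_sum; apply: eq_bigr => al _ /=.
by rewrite mevalZ mevalX mxE.
Qed.

End Forms.

(** In a chart around p, the points have the coordinates v i of the i-th row of
    Q, normalized to 1 at the c i-th place, and M is the matrix of the degree d
    monomials at these points. *)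
Section Chart.
Variables (k : fieldType) (d n : nat) (p : 'I_n -> point k) (c : 'I_n -> 'I_3).
Hypothesis cp : in_chart c p.

Let N := 'C(2 + d, d).
Let a := chart_coord c p.
Let Xc := chart_mx k c.
Let Q : 'M[k]_(n, 3) := map_mx (meval a) Xc.
Let Mx := monomial_mx d Xc.
Let M : 'M[k]_(N, n) := monomial_mx d Q.

Definition chart_pt i : 'rV[k]_3 := row i Q.
Let v := chart_pt.

Let lam i := (Defs.coord (p i) (c i))^-1.
Let lam0 i : lam i != 0. Proof. by rewrite invr_neq0. Qed.

Let QE i j : Q i j = lam i * Defs.coord (p i) j.
Proof.
rewrite !mxE; case: unliftP => [j' ->|->].
  by rewrite mevalXU /a /chart_coord mxvecE mxE mulrC.
by rewrite meval1 mulVf.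
Qed.

Let vE i : v i = lam i *: val (p i).
Proof. by apply/rowP => j; rewrite mxE QE mxE. Qed.

Lemma chart_pt_neq0 i : v i != 0.
Proof. by rewrite vE scaler_eq0 (negPf (lam0 i)) (valP (p i)). Qed.

Lemma chart_pt_eqmx i : (v i :=: val (p i))%MS.
Proof. by rewrite vE; exact: eqmx_scale. Qed.

Lemma eval_chart_pt e (f : {mpoly k[3]}) i : f \is e.-homog ->
  (f.@[v i 0] == 0) = (f.@[Defs.coord (p i)] == 0).
Proof.
move=> fe; have -> : f.@[v i 0] = lam i ^+ e * f.@[Defs.coord (p i)].
  by rewrite -(meval_scale _ _ fe); apply: meval_eq => j; rewrite vE mxE.
by rewrite mulf_eq0 expf_eq0 (negPf (lam0 i)) andbF.
Qed.

Let ME : M = map_mx (meval a) Mx.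
Proof. by rewrite monomial_mx_chart. Qed.

Lemma form_of_eval w i : (form_of w).@[v i 0] = (w *m M) 0 i.
Proof. by rewrite -eval_form_of; apply: meval_eq => j; rewrite mxE. Qed.

(** The condition that the i-th point of (P^2)^n lies on F, as a function on the
    chart. *)
Let L (F : {mpoly k[3]}) i : {mpoly k[n * 2]} := mmap (@mpolyC _ k) (Xc i) F.
Definition dform (F : {mpoly k[3]}) : 'M[k]_(n, n * 2) :=
  \matrix_(i, u) ((L F i)^`M(u)).@[a].

Let L_eval F i : (L F i).@[a] = F.@[v i 0].
Proof.
rewrite /L; elim/mpoly_ring_ind: F => [e|j|g h Eg Eh|g h Eg Eh].
- by rewrite mmapC !mevalC.
- by rewrite mmapX mmap1U mevalXU !mxE.
- by rewrite mmapD !mevalD Eg Eh.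
- by rewrite mmapM !mevalM Eg Eh.
Qed.

Let L_form w i : L (form_of w) i = \sum_al (w 0 al)%:MP * Mx al i.
Proof.
rewrite /L /form_of raddf_sum; apply: eq_bigr => al _ /=.
by rewrite mmapZ mmapX mxE.
Qed.

Lemma dformE F i i' j : dform F i (mxvec_index i' j) =
  if i == i' then (F^`M(lift (c i) j)).@[v i 0] else 0.
Proof.
rewrite mxE /L mderiv_mmap raddf_sum (bigD1_ord (c i)) //= mevalM -/(L _ i) L_eval.
rewrite mxE unlift_none mderivC meval0 mulr0 add0r.
have E j' : (Xc i (lift (c i) j'))^`M(mxvec_index i' j) = ((i == i') && (j' == j))%:R.
  rewrite mxE liftK mderivX mnm1E.
  have -> : (mxvec_index i j' == mxvec_index i' j) = (i == i') && (j' == j).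
    by rewrite (inj_eq (@cast_ord_inj _ _ _)) (inj_eq enum_rank_inj) xpair_eqE.
  case: andP => [[/eqP -> /eqP ->]|_]; last by rewrite scale0r.
  rewrite scale1r (_ : (U_(_) - U_(_))%MM = 0%MM) ?mpolyX0 //.
  by apply/mnmP => j0; rewrite mnmBE subnn mnm0E.
have [ii'|ii'] := eqVneq i i'; last first.
  by rewrite big1 // => j' _; rewrite mevalM E (negPf ii') meval0 mulr0.
rewrite -{}ii' in E *.
rewrite (bigD1 j) //= mevalM E !eqxx meval1 mulr1 -/(L _ i) L_eval big1 ?addr0 //.
by move=> j' /negPf jj; rewrite mevalM E jj andbF meval0 mulr0.
Qed.

Section Kernel.
Variable w : 'rV[k]_N.
Hypotheses (w0 : w != 0) (wM : w *m M = 0).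
Let F := form_of w.
Let jac := jacobian_mx (@X_chart_eqs k d n c) a.

Let dev u (g : {mpoly k[n * 2]}) := (g^`M(u)).@[a].

Lemma minor0 f : (@X_chart_eqs k d n c f).@[a] = 0.
Proof.
rewrite /X_chart_eqs /max_minor -det_map_mx map_mxsub -/Mx -ME.
exact: kernel_max_minors0 wM.
Qed.

Let adjM f := \adj (colsub f M : 'M_N).

(** Multiplied by the coordinate w al, a minor is a combination of the L F (f b)
    with cofactors as coefficients: expand w *m A *m \adj A for the generic
    matrix A. The L F (f b) vanish at a, so only they get differentiated. *)
Lemma det_deriv (f : {ffun 'I_N -> 'I_n}) u al :
  w 0 al * dev u (@X_chart_eqs k d n c f) = \sum_b adjM f b al * dform F (f b) u.
Proof.
have E : (w 0 al)%:MP * @X_chart_eqs k d n c f =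
    \sum_b L F (f b) * \adj (colsub f Mx : 'M_N) b al.
  pose A := colsub f Mx : 'M_N; pose wR := map_mx (@mpolyC (n * 2) k) w.
  transitivity ((wR *m (A *m \adj A)) 0 al).
    by rewrite mul_mx_adj mul_mx_scalar mxE [wR _ _]mxE mulrC.
  rewrite mulmxA mxE; apply: eq_bigr => b _; congr (_ * _).
  by rewrite L_form mxE; apply: eq_bigr => be _; rewrite !mxE.
have devS (G : 'I_N -> {mpoly k[n * 2]}) : dev u (\sum_b G b) = \sum_b dev u (G b).
  by rewrite /dev (raddf_sum (mderiv u)) raddf_sum.
have := congr1 (dev u) E; rewrite devS {1}/dev meval_mderivM mderivC meval0 mul0r add0r.
rewrite mevalC => ->; apply: eq_bigr => b _.
rewrite /dev meval_mderivM L_eval form_of_eval wM [(0 : 'rV__) _ _]mxE mul0r addr0 mulrC.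
rewrite [dform _ _ _]mxE; congr (_ * _).
by rewrite /adjM ME -map_mxsub -map_mx_adj [RHS]mxE.
Qed.

Let fv (t : 'I_#|{: {ffun 'I_N -> 'I_n}}|) : {ffun 'I_N -> 'I_n} := enum_val t.

(** The adjugates of the matrices of columns fv t, extended by zero to all n
    points; a repeated column collects several cofactors. *)
Let Kmx al : 'M[k]_(#|{: {ffun 'I_N -> 'I_n}}|, n) :=
  \matrix_(t, i) \sum_(b | fv t b == i) adjM (fv t) b al.

Let Kmx_jac al : w 0 al *: jac = Kmx al *m dform F.
Proof.
apply/matrixP => t u; rewrite !mxE det_deriv.
rewrite (partition_big (fv t) xpredT) //=; apply: eq_bigr => i _.
by rewrite mxE mulr_suml; apply: eq_bigr => b /eqP ->.
Qed.

Let Kmx_ker al : (Kmx al <= kermx M^T)%MS.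
Proof.
apply/sub_kermxP/matrixP => t be; rewrite mxE [RHS]mxE.
have := mul_mx_adj (colsub (fv t) M : 'M_N).
rewrite (kernel_max_minors0 _ w0 wM) => /matrixP/(_ be al).
rewrite [RHS]mxE mul0rn => E; rewrite -[RHS]E mxE.
rewrite [RHS](partition_big (fv t) xpredT) //=; apply: eq_bigr => i _.
rewrite 2!mxE mulr_suml; apply: eq_bigr => b /eqP <-.
by rewrite mulrC [colsub _ _ _ _]mxE.
Qed.

(** The rows of Kmx al are relations between the columns of M, because
    M_f *m \adj M_f = 0. *)
Lemma jac_sub : (jac <= kermx M^T *m dform F)%MS.
Proof.
have /rV0Pn [al wal] := w0; rewrite -(eqmx_scale _ wal) Kmx_jac.
exact/submxMr/Kmx_ker.
Qed.

(** All cofactors of size N - 1 vanish. *)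
Lemma jac_eq0 : (\rank M < N.-1)%N -> jac = 0.
Proof.
move=> rM; have /rV0Pn [al wal] := w0.
suff K0 : Kmx al = 0.
  by apply: (scalerI wal); rewrite Kmx_jac K0 mul0mx scaler0.
apply/matrixP => t i; rewrite !mxE big1 // => b _.
rewrite mxE /cofactor (_ : \det _ = 0) ?mulr0 //.
set A := row' _ _; apply/eqP; apply: contraT; rewrite -unitfE -unitmxE -row_free_unit.
rewrite /row_free => /eqP rA.
suff : (\rank A <= \rank M)%N by rewrite rA leqNgt rM.
rewrite /A row'Esub -[X in rowsub _ X]trmxK tr_col' row'Esub.
rewrite (leq_trans (mxrankS (rowsub_sub _ _))) // mxrank_tr.
rewrite (leq_trans (mxrankS (rowsub_sub _ _))) // trmx_mxsub.
by rewrite -(mxrank_tr M) mxrankS // rowsub_sub.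
Qed.

End Kernel.

(** The derivative in the c i-th direction, which the chart does not see, is
    given by Euler's formula. *)
Lemma singular_of_dform (F : {mpoly k[3]}) i : F \is d.-homog -> F.@[v i 0] = 0 ->
    (forall j, dform F i (mxvec_index i j) = 0) ->
  forall l, F^`M(l).@[v i 0] = 0.
Proof.
move=> Fd Fv dF l.
have dl j : F^`M(lift (c i) j).@[v i 0] = 0 by rewrite -(dF j) dformE eqxx.
case: (unliftP (c i) l) => [j ->|->] //.
have := congr1 (meval (v i 0)) (euler_homog Fd).
rewrite mevalMn Fv mul0rn raddf_sum (bigD1_ord (c i)) //= big1 => [|j _].
  by rewrite addr0 mevalM mevalXU [v i 0 _]mxE QE /lam mulVf // mul1r.
by rewrite mevalM dl mulr0.
Qed.

(** The curve w is the only one through the points, and the points among them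
    that are singular on it are distinct. *)
Section SmoothChart.
Variable w : 'rV[k]_N.
Hypotheses (hk : [pchar k] =i pred0) (hd : (0 < d)%N) (hn : (N <= n)%N).
Hypotheses (w0 : w != 0) (wM : w *m M = 0) (wuniq : (kermx M <= w)%MS).
Let F := form_of w.
Hypothesis Fdist : forall i j, i != j ->
  (forall l, F^`M(l).@[v i 0] = 0) -> (forall l, F^`M(l).@[v j 0] = 0) ->
  ~~ (v j <= v i)%MS.
Let jac := jacobian_mx (@X_chart_eqs k d n c) a.

Lemma rank_M : (\rank M).+1 = N.
Proof.
have := rank_rV w; rewrite w0.
have -> : \rank w = \rank (kermx M).
  by apply/eqP; rewrite eqn_leq !mxrankS //; apply/sub_kermxP.
by rewrite mxrank_ker; have := rank_leq_row M; move: (\rank M) => r /=; lia.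
Qed.

(** A relation between the columns of M that is killed by dform F is supported on
    singular points, and it is a relation between the values of the forms of
    degree d. *)
Lemma dform_independent : (kermx M^T :&: kermx (dform F))%MS = 0.
Proof.
apply/eqP/rowV0P => kap; rewrite sub_capmx => /andP [/sub_kermxP kM /sub_kermxP kF].
have kv i j : kap 0 i * dform F i (mxvec_index i j) = 0.
  have /rowP/(_ (mxvec_index i j)) := kF; rewrite mxE [RHS]mxE (bigD1 i) //=.
  rewrite big1 ?addr0 // => i' i'i; rewrite dformE (negPf i'i) mulr0 //.
have Fv i : F.@[v i 0] = 0 by rewrite form_of_eval wM mxE.
have ks i : kap 0 i != 0 -> forall l, F^`M(l).@[v i 0] = 0.
  move=> ki; apply: singular_of_dform; [exact: form_of_homog | exact: Fv | move=> j].
  by have /eqP := kv i j; rewrite mulf_eq0 (negPf ki) => /eqP.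
apply/rowP => i; rewrite mxE.
apply: (@singular_points_independent k hk d n v F (fun i => kap 0 i)) => //.
- exact: form_of_homog.
- by apply: contraNneq w0 => F0; rewrite -(form_ofK w) -/F F0; apply/eqP/rowP => al; rewrite !mxE mcoeff0.
- exact: chart_pt_neq0.
- move=> D Dd Dv; have /sub_rVP [e Ew] : (coefs_of d D <= w)%MS.
    apply: submx_trans wuniq; apply/sub_kermxP/rowP => i'.
    by rewrite -form_of_eval coefs_ofK // Dv mxE.
  exists e; rewrite -(coefs_ofK Dd) Ew /F /form_of scaler_sumr.
  by apply: eq_bigr => al _; rewrite mxE scalerA.
- by move=> i' j ij ki kj; apply: Fdist => //; apply: ks.
move=> f fd; have := congr1 (fun A : 'rV_N => (coefs_of d f *m A^T) 0 0) kM.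
rewrite trmx0 mulmx0 [RHS]mxE => E; rewrite -[RHS]E.
rewrite trmx_mul trmxK mulmxA [RHS]mxE; apply: eq_bigr => i' _.
by rewrite -form_of_eval coefs_ofK // mxE mulrC.
Qed.

Lemma rank_ker_dform : \rank (kermx M^T *m dform F) = (n - N.-1)%N.
Proof.
have := mxrank_mul_ker (kermx M^T) (dform F).
rewrite dform_independent mxrank0 addn0 => ->.
rewrite mxrank_ker mxrank_tr; congr (n - _)%N; apply: succn_inj.
by rewrite rank_M prednK // bin_gt0 leq_addl.
Qed.

Let dev u (g : {mpoly k[n * 2]}) := (g^`M(u)).@[a].

Let dform_form u i (e : 'rV[k]_N) :
  dform (form_of e) i u = \sum_al e 0 al * dev u (Mx al i).
Proof.
rewrite mxE L_form (raddf_sum (mderiv u)) raddf_sum; apply: eq_bigr => al _ /=.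
by rewrite meval_mderivM mderivC meval0 mul0r add0r mevalC.
Qed.

(** Fix N - 1 independent columns f of M, and let g i be f with the free place
    b0 filled by the column i. The minor g i is W *m (column i of Mx), for the
    vector W of cofactors, which at the point is proportional to w; it vanishes
    identically for i in f, and E is the set of the other i. The differentials of
    the minors g i are e times those of L F, up to a combination of the rows
    of M^T, whence their rank. If these minors are in a prime P at the point, then
    W is a nonzero vector in the kernel of the matrix Mx over the residue field
    of P, and so all maximal minors are in P. *)
Lemma good_minors : exists (E : {set 'I_n}) (g : 'I_n -> {ffun 'I_N -> 'I_n}),
  [/\ #|E| = (n - N.-1)%N,
      row_free (\matrix_(i < #|E|, u < n * 2)
         dev u (@X_chart_eqs k d n c (g (enum_val i)))) &
      forall P : {pred {mpoly k[n * 2]}}, idealr_closed P -> prime_idealr_closed P ->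
        (forall h, h \in P -> h.@[a] = 0) ->
        (forall i, i \in E -> @X_chart_eqs k d n c (g i) \in P) ->
        forall f, @X_chart_eqs k d n c f \in P].
Proof.
have N0 : (0 < N)%N by rewrite bin_gt0 leq_addl.
have [f [b0 [f_inj [al0 fal0]]]] := exists_cofactor (Ordinal (leq_trans N0 hn)) rank_M.
pose g := set_col f b0; pose E := ~: (f @: [set~ b0]); exists E, g.
pose W al := \adj (colsub f Mx : 'M_N) b0 al.
have gW i : @X_chart_eqs k d n c (g i) = \sum_al W al * Mx al i.
  by rewrite /X_chart_eqs /max_minor -det_set_col.
have g0 i : i \notin E -> @X_chart_eqs k d n c (g i) = 0.
  rewrite inE negbK => /imsetP [b]; rewrite !inE => bb0 ->.
  exact: det_set_col0.
pose w' : 'rV[k]_N := \row_al \adj (colsub f M : 'M_N) b0 al.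
have Wa al : (W al).@[a] = w' 0 al.
  by rewrite /w' ME -map_mxsub -map_mx_adj 2![RHS]mxE.
have cE : #|E| = (n - N.-1)%N.
  by rewrite cardsCs setCK card_in_imset // cardsC1 !card_ord.
pose JG : 'M[k]_(n, n * 2) := \matrix_(i, u) dev u (@X_chart_eqs k d n c (g i)).
have w'M : w' *m M = 0.
  apply/rowP => i; rewrite mxE [RHS]mxE.
  have := minor0 w0 wM (g i); rewrite gW raddf_sum => E0; rewrite -[RHS]E0.
  by apply: eq_bigr => al _; rewrite /= mevalM Wa ME; congr (_ * _); rewrite mxE.
have [e Ew'] : exists e, w' = e *: w.
  by apply/sub_rVP; apply: submx_trans wuniq; apply/sub_kermxP.
have e0 : e != 0.
  apply: contraNneq fal0 => e0; have := congr1 (fun A : 'rV_N => A 0 al0) Ew'.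
  by rewrite e0 scale0r mxE [RHS]mxE => ->.
have JGE : JG = M^T *m (\matrix_(al, u) dev u (W al)) + e *: dform F.
  apply/matrixP => i u; rewrite mxE gW [RHS]mxE [X in _ = _ + X]mxE dform_form [X in _ = X + _]mxE.
  rewrite mulr_sumr -big_split /dev (raddf_sum (mderiv u)) raddf_sum.
  apply: eq_bigr => al _ /=.
  rewrite meval_mderivM Wa Ew' [X in _ + X * _]mxE -mulrA; congr (_ + _).
  rewrite mulrC [M^T _ _]mxE [X in _ = _ * X]mxE ME; congr (_ * _).
  by rewrite [RHS]mxE.
have rJG : (n - N.-1 <= \rank JG)%N.
  rewrite -rank_ker_dform -(mxrank_scale_nz _ e0).
  have -> : e *: (kermx M^T *m dform F) = kermx M^T *m JG.
    by rewrite JGE mulmxDr mulmxA mulmx_ker mul0mx add0r scalemxAr.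
  exact: mxrankM_maxr.
split=> //.
  set JE := \matrix_(i, u) _; rewrite /row_free eqn_leq rank_leq_row /= {1}cE.
  apply: leq_trans rJG _; apply: mxrankS; apply/row_subP => i.
  have [iE|/g0 gi0] := boolP (i \in E); last first.
    by rewrite (_ : row i JG = 0) ?sub0mx //; apply/rowP => u; rewrite !mxE gi0 /dev linear0 meval0.
  apply: (@eq_row_sub _ _ _ _ _ (enum_rank_in iE i)); apply/rowP => u.
  by rewrite !mxE enum_rankK_in.
move=> P Pi Pp Pa PE h.
have [K [pi piP]] := prime_field Pi Pp.
apply/idP; rewrite -piP /X_chart_eqs /max_minor -det_map_mx map_mxsub -/Mx.
apply/eqP; apply: (@kernel_max_minors0 _ _ _ _ (\row_al pi (W al))).
  apply: contraNneq fal0 => /(congr1 (fun A : 'rV_N => A 0 al0)); rewrite mxE [RHS]mxE.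
  by move/eqP; rewrite piP => /Pa; rewrite Wa mxE => ->.
apply/rowP => i; rewrite mxE [RHS]mxE.
transitivity (pi (@X_chart_eqs k d n c (g i))).
  by rewrite gW rmorph_sum; apply: eq_bigr => al _; rewrite !mxE rmorphM.
apply/eqP; rewrite piP; have [/PE //|/g0 ->] := boolP (i \in E).
by case: Pi.
Qed.

(** Complete the minors of good_minors by linear forms vanishing at a to a system
    of parameters T of the affine space at a. In the chain of primes that T
    provides, the primes from the #|E|-th one on contain all maximal minors. *)
Lemma chain_at_point : exists P, prime_chain (@X_chart_eqs k d n c) a (n + N.-1) P.
Proof.
have [E [g [cE fE PE]]] := good_minors.
set JE := \matrix_(i, u) _ in fE.
pose e := \rank (JE^C)%MS.
have rJE : \rank JE = #|E| by apply/eqP.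
have NE : (N.-1 < n)%N by rewrite (leq_trans _ hn) // prednK // bin_gt0 leq_addl.
have eE : e = (n + N.-1)%N.
  rewrite /e mxrank_compl rJE cE; move: NE; clear; lia.
pose T (x : 'I_(#|E| + e)) : {mpoly k[n * 2]} :=
  match split x with
  | inl i => @X_chart_eqs k d n c (g (enum_val i))
  | inr j => \sum_u row_base (JE^C)%MS j u *: ('X_u - (a u)%:MP)
  end.
have Ta x : (T x).@[a] = 0.
  rewrite /T; case: (split x) => [i|j]; first exact: (minor0 w0 wM).
  rewrite raddf_sum big1 // => u _ /=.
  by rewrite mevalZ mevalB mevalXU mevalC subrr mulr0.
have JT : \matrix_(x, u) ((T x)^`M(u)).@[a] = col_mx JE (row_base (JE^C)%MS).
  apply/matrixP => x u; rewrite mxE; case: (split_ordP x) => [i|j] ->.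
    by rewrite col_mxEu /T (unsplitK (inl i)) mxE.
  rewrite col_mxEd /T (unsplitK (inr j)) (raddf_sum (mderiv u)) raddf_sum.
  rewrite (bigD1 u) //= big1 => [|u' u'u].
    rewrite mderivZ mderivB mderivC subr0 mderivX mnm1E eqxx scale1r mevalZ.
    rewrite (_ : (U_(u) - U_(u))%MM = 0%MM) ?mpolyX0 ?meval1 ?mulr1 ?addr0 //.
    by apply/mnmP => j0; rewrite mnmBE subnn mnm0E.
  rewrite mderivZ mderivB mderivC subr0 mderivX mnm1E (negPf u'u) scale0r.
  by rewrite scaler0 meval0.
have fT : row_free (\matrix_(x, u) ((T x)^`M(u)).@[a]).
  rewrite JT /row_free -addsmxE (adds_eqmx (eqmx_refl _) (eq_row_base _)).
  have /eqP -> := addsmx_compl_full JE.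
  by rewrite cE eE; move: NE; clear; lia.
have [I [Qp Qs QT Qa]] := regular_chain Ta fT.
exists (fun j => I (#|E| + j)%N); split.
- by move=> i _; exact: Qp.
- move=> i; rewrite -eE => ie; rewrite addnS; split; first exact: Qs.
  by exists (T (rshift _ (Ordinal ie))); rewrite QT /= ?ltnn // ltnS.
- move=> f; rewrite addn0; apply: PE; [exact: (Qp _).1 | exact: (Qp _).2 | exact: Qa |].
  move=> i iE; have := QT #|E| (lshift e (enum_rank_in iE i)).
  by rewrite /T (unsplitK (inl _)) enum_rankK_in // /= ltn_ord => ->.
by move=> h; exact: Qa.
Qed.

Lemma smooth_chart : smooth_affine (@X_chart_eqs k d n c) a.
Proof.
have [E [g [cE fE _]]] := good_minors.
set JE := \matrix_(i, u) _ in fE.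
have NE : (N.-1 < n)%N by rewrite (leq_trans _ hn) // prednK // bin_gt0 leq_addl.
have rj : \rank jac = (n - N.-1)%N.
  apply/eqP; rewrite eqn_leq -{1}rank_ker_dform mxrankS ?(jac_sub w0 wM) //=.
  rewrite -cE -(eqP fE) mxrankS //; apply/row_subP => i.
  apply: (@eq_row_sub _ _ _ _ _ (enum_rank (g (enum_val i)))); apply/rowP => u.
  by rewrite !mxE enum_rankK.
rewrite /smooth_affine /tangent_dim /tangent_mx mxrank_ker mxrank_tr.
rewrite -/jac rj (_ : (n * 2 - _)%N = (n + N.-1)%N); last by move: NE; clear; lia.
split; first exact: chain_at_point.
by move=> l [P chP]; exact: X_chain_length chP.
Qed.

End SmoothChart.

End Chart.

(** * Smooth points and the curves through them *)

Section Curves.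
Variables (k : fieldType) (d n : nat) (p : 'I_n -> point k) (c : 'I_n -> 'I_3).
Hypothesis cp : in_chart c p.

Let a := chart_coord c p.
Let M : 'M[k]_('C(2 + d, d), n) :=
  monomial_mx d (map_mx (meval a) (chart_mx k c)).
Let jac := jacobian_mx (@X_chart_eqs k d n c) a.

Lemma passes_throughP w : passes_through (form_of w) p <-> w *m M = 0.
Proof.
split=> [H|wM i].
  apply/rowP => i; rewrite -form_of_eval [RHS]mxE; apply/eqP.
  by rewrite (eval_chart_pt cp _ (form_of_homog w)); apply/eqP; exact: H.
apply/eqP; rewrite -(eval_chart_pt cp i (form_of_homog w)).
by rewrite form_of_eval wM mxE.
Qed.

Lemma form_of_neq0 (w : 'rV[k]_('C(2 + d, d))) : (form_of w != 0) = (w != 0).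
Proof.
congr (~~ _); apply/eqP/eqP => [F0|->].
  by rewrite -(form_ofK w) F0; apply/rowP => al; rewrite !mxE mcoeff0.
by rewrite /form_of big1 // => al _; rewrite mxE scale0r.
Qed.

Lemma is_curve_form_of (w : 'rV[k]_('C(2 + d, d))) :
  w != 0 -> is_curve d (form_of w).
Proof. by rewrite -form_of_neq0; split=> //; exact: form_of_homog. Qed.

Lemma same_curveP (w w' : 'rV[k]_('C(2 + d, d))) :
  w' != 0 -> same_curve (form_of w) (form_of w') <-> (w' <= w)%MS.
Proof.
move=> w'0; split=> [[e e0 E]|/sub_rVP [e E]].
  apply/sub_rVP; exists e; rewrite -(form_ofK w') E -[in RHS](form_ofK w).
  by apply/rowP => al; rewrite !mxE mcoeffZ.
exists e; first by apply: contraNneq w'0 => e0; rewrite E e0 scale0r.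
rewrite E /form_of scaler_sumr.
by apply: eq_bigr => al _; rewrite mxE scalerA.
Qed.

Lemma sing_curveP (w : 'rV[k]_('C(2 + d, d))) i : w *m M = 0 ->
  sing_curve (form_of w) (p i) <->
    forall l, ((form_of w)^`M(l)).@[chart_pt p c i 0] = 0.
Proof.
move=> wM; have Hd l := mderiv_homog l (form_of_homog w).
split=> [[_ H] l|H].
  by apply/eqP; rewrite (eval_chart_pt cp _ (Hd l)); apply/eqP.
split; first by move/passes_throughP: wM; apply.
by move=> l; apply/eqP; rewrite -(eval_chart_pt cp i (Hd l)); apply/eqP.
Qed.

Lemma same_point_chart i j :
  same_point (p i) (p j) = (chart_pt p c j <= chart_pt p c i)%MS.
Proof.
rewrite /same_point !(chart_pt_eqmx cp); apply/andP/idP => [[]//|ji].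
split=> //; have [_ <-] := mxrank_leqif_sup ji.
by rewrite !rank_rV !(valP (p _)).
Qed.

Hypothesis hn : ('C(2 + d, d) <= n)%N.

Let N0 : (0 < 'C(2 + d, d))%N. Proof. by rewrite bin_gt0 leq_addl. Qed.

(** Smoothness provides a chain whose length is the dimension 2n - \rank jac of
    the tangent space, and the length of a chain is at most n + N - 1. *)
Lemma rank_jac_smooth : smooth_affine (@X_chart_eqs k d n c) a ->
  (n - ('C(2 + d, d)).-1 <= \rank jac)%N.
Proof.
case=> [[P /X_chain_length]] + _; rewrite /tangent_dim mxrank_ker mxrank_tr -/jac.
have := rank_leq_col jac; move: (\rank jac) => r; clear; lia.
Qed.

Section Smooth.
Variable w : 'rV[k]_('C(2 + d, d)).
Hypotheses (w0 : w != 0) (wM : w *m M = 0).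
Hypothesis rjac : (n - ('C(2 + d, d)).-1 <= \rank jac)%N.

(** The Jacobian is nonzero as its rank is positive, so jac_eq0 bounds the rank
    of M from below. *)
Lemma smooth_unique : (kermx M <= w)%MS.
Proof.
have rM : (('C(2 + d, d)).-1 <= \rank M)%N.
  rewrite leqNgt; apply/negP => /(jac_eq0 w0 wM) j0; move: rjac.
  by rewrite /jac j0 mxrank0; move: N0 hn; clear; lia.
have wk : (w <= kermx M)%MS by apply/sub_kermxP.
have := mxrank_leqif_sup wk; case=> _; rewrite rank_rV w0 mxrank_ker => <-.
have := mxrankS wk; rewrite rank_rV w0 mxrank_ker.
by move: rM N0; clear; lia.
Qed.

(** If the points i and j are equal, then v j = e *: v i and the columns of M are
    proportional by e ^ d. This relation kap is killed by dform when both points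
    are singular, so the rank of kermx M^T *m dform F, and of the Jacobian with
    it, is less than n - N + 1. *)
Lemma smooth_singular_distinct i j : i != j ->
  sing_curve (form_of w) (p i) -> sing_curve (form_of w) (p j) ->
  ~~ same_point (p i) (p j).
Proof.
move=> ij /(sing_curveP _ wM) si /(sing_curveP _ wM) sj.
rewrite same_point_chart; apply/negP => /sub_rVP [e ve].
pose kap : 'rV[k]_n := delta_mx 0 j - e ^+ d *: delta_mx 0 i.
have kap0 : kap != 0.
  apply/eqP => /rowP/(_ j); rewrite !mxE !eqxx eq_sym (negPf ij) mulr0 subr0.
  by move/eqP; rewrite oner_eq0.
have rowM l : row l M^T = \row_al \prod_(t < 3) chart_pt p c l 0 t ^+ (mexp al) t.
  by apply/rowP => al; rewrite !mxE; apply: eq_bigr => t _; rewrite !mxE.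
have kM : kap *m M^T = 0.
  rewrite mulmxBl -scalemxAl -!rowE !rowM; apply/rowP => al; rewrite !mxE ve.
  apply/eqP; rewrite subr_eq0; apply/eqP.
  under eq_bigr do rewrite mxE exprMn.
  by rewrite big_split prodrXr -mdegE mdeg_mexp.
have rowD l : (forall t, ((form_of w)^`M(t)).@[chart_pt p c l 0] = 0) ->
    row l (dform p c (form_of w)) = 0.
  move=> sl; apply/rowP => u; rewrite mxE [RHS]mxE.
  by case/mxvec_indexP: u => i' t; rewrite dformE sl if_same.
have kD : kap *m dform p c (form_of w) = 0.
  by rewrite mulmxBl -scalemxAl -!rowE !rowD // scaler0 subrr.
have := mxrank_mul_ker (kermx M^T) (dform p c (form_of w)).
have : (kap <= kermx M^T :&: kermx (dform p c (form_of w)))%MS.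
  by rewrite sub_capmx; apply/andP; split; apply/sub_kermxP.
move/mxrankS; rewrite rank_rV kap0 => r1.
have := mxrankS (jac_sub w0 wM); rewrite -/jac -/M => r2 r3.
have rM : (('C(2 + d, d)).-1 <= \rank M)%N.
  have := mxrankS smooth_unique; rewrite rank_rV w0 mxrank_ker; clear; lia.
move: r3; rewrite mxrank_ker mxrank_tr; move: r1 r2 rM rjac N0 hn.
by clear; lia.
Qed.

End Smooth.
End Curves.

Theorem theorem3 (k : fieldType) (hk : [pchar k] =i pred0) (d n : nat)
    (hd : (2 <= d)%N) (hn : ('C(2 + d, d) <= n)%N)
    (p : 'I_n -> point k) (hp : in_X d p) :
  smooth_point_X d p <->
  exists C : {mpoly k[3]},
    [/\ is_curve d C,
        passes_through C p,
        forall D : {mpoly k[3]},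
          is_curve d D -> passes_through D p -> same_curve C D
      & sing_points_distinct C p].
Proof.
split=> [[c [cp smooth]]|[C [[C0 Cd] Cp Cuniq Csing]]].
  have [w w0 wX] := max_minors0_kernel hp.
  have wp : passes_through (form_of w) p.
    move=> i; transitivity ((form_of w).@[points_mx p i]).
      by apply: meval_eq => j; rewrite mxE.
    by rewrite eval_form_of wX mxE.
  have wM := (passes_throughP cp w).1 wp.
  have rjac := rank_jac_smooth smooth.
  exists (form_of w); split=> //.
  - exact: is_curve_form_of.
  - move=> D [D0 Dd]; rewrite -(coefs_ofK Dd) in D0 * => /(passes_throughP cp) DM.
    rewrite form_of_neq0 in D0; apply/(same_curveP _ D0).
    apply: submx_trans (smooth_unique hn w0 wM rjac); exact/sub_kermxP.
  - by move=> i j; exact: smooth_singular_distinct.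
have cp0 i : exists j, Defs.coord (p i) j != 0.
  by have /rV0Pn := valP (p i).
pose c i := xchoose (cp0 i).
have cp : in_chart c p by move=> i; exact: xchooseP (cp0 i).
exists c; split=> //.
rewrite -(coefs_ofK Cd) in C0 Cp Cuniq Csing.
set w := coefs_of d C in C0 Cp Cuniq Csing; rewrite form_of_neq0 in C0.
have wM := (passes_throughP cp w).1 Cp.
apply: (smooth_chart cp hk _ hn C0 wM) => [||i j ij si sj].
- exact: ltnW.
- apply/row_subP => i; set w' := row i _.
  have [->|w'0] := eqVneq w' 0; first exact: sub0mx.
  apply/(same_curveP _ w'0)/Cuniq; first exact: is_curve_form_of.
  by apply/(passes_throughP cp)/sub_kermxP; exact: row_sub.
rewrite -(same_point_chart cp); apply: Csing => //.
  exact/(sing_curveP cp _ wM).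
exact/(sing_curveP cp _ wM).
Qed.
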